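(* Let $m$ be a positive integer, let $\mathrm{type}$ be a type attribution for $h_n^m$, and let $F_{m,k}:\mathrm{SYT}_m^k\to\mathrm{SYT}_m$ be a Kronecker map. Let $\lambda=(\lambda_1,\dots,\lambda_k)$ be a partition and $h_\lambda=h_{\lambda_1}\cdots h_{\lambda_k}$. For a semistandard tableau $T$ of content $\lambda^m$ with $\mathrm{Dec}_m(T)=(T_1,\dots,T_k)$, define $\mathrm{type}(T)=F_{m,k}(\mathrm{type}(T_1),\dots,\mathrm{type}(T_k))$. Then for every $t\in\mathrm{SYT}_m$, $$s_{\mathrm{shape}(t)}[h_\lambda]=\sum_T s_{\mathrm{shape}(T)},$$ the sum running over all semistandard tableaux $T$ of content $\lambda^m$ with $\mathrm{type}(T)=t$.
   Context: Semistandard tableaux have weakly increasing rows and strictly increasing columns. $\mathrm{SYT}_m$: standard Young tableaux with $m$ cells. $s_\mu$ Schur functions, $h_n=s_{(n)}$, $f[g]$ plethysm. A type attribution for $h_n^m$ is a function $\mathrm{type}$ from the set of all semistandard tableaux of content $(n)^m$ (each of $1,\dots,m$ occurring $n$ times), over all $n\ge1$ and shapes, to $\mathrm{SYT}_m$, such that for all $n\ge1$, $t\in\mathrm{SYT}_m$: $s_{\mathrm{shape}(t)}[h_n]=\sum_{T\text{ of content }(n)^m,\ \mathrm{type}(T)=t}s_{\mathrm{shape}(T)}$. A Kronecker map is a map $F_{m,k}:\mathrm{SYT}_m^k\to\mathrm{SYT}_m$ such that for all symmetric functions $f_1,\dots,f_k$ and all $t\in\mathrm{SYT}_m$, $s_{\mathrm{shape}(t)}[f_1\cdots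 f_k]=\sum_{(t_1,\dots,t_k)\in F_{m,k}^{-1}(t)}\prod_{i=1}^k s_{\mathrm{shape}(t_i)}[f_i]$. A tableau has content $\lambda^m$ if for each $i\le k$ and $r\le m$ the entry $(i-1)m+r$ appears $\lambda_i$ times. $\mathrm{Dec}_m(T)=(T_1,\dots,T_k)$ where $T_i=\mathrm{Rect}(\widetilde T^{(i)})$, $\widetilde T^{(i)}$ being the skew tableau of cells of $T$ with entries in $\{(i-1)m+1,\dots,im\}$ with $(i-1)m$ subtracted from every entry, and $\mathrm{Rect}$ the rectification by Schützenberger's jeu de taquin; $T_i$ has content $(\lambda_i)^m$. *)

(* Defs.v *)
From HB Require Import structures.
From Stdlib Require Import ClassicalEpsilon.
From mathcomp Require Import all_boot all_order all_algebra.
From mathcomp Require Export mpoly.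

Set Implicit Arguments.
Unset Strict Implicit.
Unset Printing Implicit Defensive.

Import GRing.Theory.

(** * Tableaux *)

(* A tableau is the list of its rows, top row first (English convention).
   Entries are counted from 0: the natural number x stands for the letter
   x + 1. *)
Notation tableau := (seq (seq nat)).

Definition is_partition (mu : seq nat) : bool := sorted geq mu && (0 \notin mu).

Definition column_strict (r1 r2 : seq nat) : bool :=
  all (fun j => nth 0 r1 j < nth 0 r2 j) (iota 0 (size r2)).

Definition semistandard (T : tableau) : bool :=
  [&& is_partition (shape T), all (sorted leq) T & sorted column_strict T].

(* c`_x is the number of occurrences of x; entries are < size c. *)
Definition has_content (c : seq nat) (T : tableau) : bool :=
  all (fun x => x < size c) (flatten T) &&
  [forall x : 'I_(size c), count_mem (x : nat) (flatten T) == nth 0 c x].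

Record SSYT (c : seq nat) := MkSSYT {
  tableau_of :> tableau;
  _ : semistandard tableau_of && has_content c tableau_of
}.

HB.instance Definition _ c := [isSub for @tableau_of c].
HB.instance Definition _ c := [Countable of SSYT c by <:].

Section FiniteSSYT.
Variable c : seq nat.
Let n := sumn c.

Lemma size_flatten_content (T : tableau) :
  has_content c T -> size (flatten T) = n.
Proof.
case/andP=> ltc /forallP cnt.
have -> : size (flatten T) = \sum_(x < size c) count_mem (x : nat) (flatten T).
  elim: (flatten T) ltc {cnt} => [|a s IH] /=; first by rewrite big1.
  case/andP=> ac /IH ->; rewrite big_split -add1n /=; congr addn.
  rewrite (bigD1 (Ordinal ac)) //= eqxx big1 // => i /negPf.
  by rewrite -val_eqE /= eq_sym => ->.
rewrite /n sumnE (big_nth 0) big_mkord; apply: eq_bigr => x _.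
exact/eqP.
Qed.

Definition SSYT_code (T : SSYT c) :
    {bseq n of 'I_n.+1} * {bseq n of 'I_(size c)} :=
  (insub_bseq n (pmap insub (shape T)), insub_bseq n (pmap insub (flatten T))).

Definition SSYT_decode
    (p : {bseq n of 'I_n.+1} * {bseq n of 'I_(size c)}) : option (SSYT c) :=
  insub (reshape (map val p.1) (map val p.2)).

Lemma SSYT_codeK : pcancel SSYT_code SSYT_decode.
Proof.
case=> T /= PT; rewrite /SSYT_decode /SSYT_code /=.
have [/and3P[/andP[_ sh0] _ _] cT] := andP PT.
have szf := size_flatten_content cT.
have pmK k (s : seq nat) : all (fun x => x < k) s ->
    map val (pmap insub s : seq 'I_k) = s.
  by elim: s => //= a s IH /andP[ak /IH h]; rewrite insubT /= h.
have szp k (s : seq nat) : all (fun x => x < k) s ->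
    size (pmap insub s : seq 'I_k) = size s.
  by move=> /pmK {2}<-; rewrite size_map.
have shn : sumn (shape T) = n by rewrite -szf size_flatten.
have bsh : all (fun x => x < n.+1) (shape T).
  apply/allP=> x xT; rewrite ltnS -shn.
  by rewrite (perm_sumn (perm_to_rem xT)) /= leq_addr.
have bfl : all (fun x => x < size c) (flatten T) by case/andP: cT.
have ssh : size (shape T) <= n.
  rewrite -shn; elim: (shape T) sh0 => //= a s IH.
  rewrite inE negb_or eq_sym -lt0n => /andP[a0 /IH h].
  by rewrite -add1n leq_add.
have bs k (s : seq k) : size s <= n -> insub_bseq n s = s :> seq _.
  by move=> h; rewrite /insub_bseq insubdK.
rewrite !bs ?szp ?szf // !pmK // flattenK.
by rewrite insubT.
Qed.

HB.instance Definition _ : isFinite (SSYT c) := PCanIsFinite SSYT_codeK.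
End FiniteSSYT.

Definition SYT (m : nat) := SSYT (nseq m 1).
HB.instance Definition _ m := Finite.on (SYT m).

(* Content lam^m: the entry i * m + r (r < m) occurs lam_i times. *)
Definition content_pow (lam : seq nat) (m : nat) : seq nat :=
  flatten [seq nseq m l | l <- lam].

(** * Jeu de taquin *)

(* Skew tableaux are also stored row by row, an empty box [None] marking the
   cells of the inner shape (and, during a slide, the hole). *)
Notation skew_tableau := (seq (seq (option nat))).

Definition box (S : skew_tableau) (i j : nat) : option nat :=
  nth None (nth [::] S i) j.

Definition put_box (S : skew_tableau) (i j : nat) (x : option nat) :=
  set_nth [::] S i (set_nth None (nth [::] S i) j x).

Definition remove_box (S : skew_tableau) (i j : nat) : skew_tableau :=
  set_nth [::] S i (take j (nth [::] S i)).

(* Jeu de taquin slide into the hole (i, j): the smaller of the entries below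
   and to the right moves into the hole, the entry below in case of a tie. *)
Fixpoint slide_rec (fuel : nat) (S : skew_tableau) (i j : nat) : skew_tableau :=
  if fuel isn't fuel'.+1 then S else
  let down b := slide_rec fuel' (put_box (put_box S i j (Some b)) i.+1 j None)
                  i.+1 j in
  let right r := slide_rec fuel' (put_box (put_box S i j (Some r)) i j.+1 None)
                  i j.+1 in
  match box S i.+1 j, box S i j.+1 with
  | None, None => remove_box S i j
  | Some b, None => down b
  | None, Some r => right r
  | Some b, Some r => if b <= r then down b else right r
  end.

(* The hole visits each box at most once, so this fuel never runs out. *)
Definition slide (S : skew_tableau) (i j : nat) : skew_tableau :=
  slide_rec (size (flatten S)) S i j.

(* The slide into the lowest inner corner. Rectification does not depend on the
   order in which the inner corners are chosen. *)
Definition slide_corner (S : skew_tableau) : skew_tableau :=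
  let i := last 0 [seq i <- iota 0 (size S) | None \in nth [::] S i] in
  slide S i (count_mem None (nth [::] S i)).-1.

Definition rect (S : skew_tableau) : tableau :=
  [seq pmap id row
     | row <- iter (count_mem None (flatten S)) slide_corner S & row != [::]].

Definition skew_part (m i : nat) (T : tableau) : skew_tableau :=
  [seq [seq (if x < i * m then None else Some (x - i * m))
          | x <- row & x < i.+1 * m]
     | row <- T].

(* The i-th component (i counted from 0) of Dec_m. *)
Definition Dec (m i : nat) (T : tableau) : tableau := rect (skew_part m i T).

(** * Symmetric functions and plethysm *)

Local Open Scope ring_scope.

(* A symmetric function over the rationals is a family of symmetric polynomials
   in N variables, one for each N, of bounded degree and compatible with setting
   the last variable to 0; two of them are equal when they agree for every N. *)
Definition family := forall N : nat, {mpoly rat[N]}.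

Definition symmetric_function (f : family) : Prop :=
  [/\ forall N, f N \is symmetric,
      forall N, f N.+1 \mPo
        [tuple if unlift ord_max i is Some j then 'X_j else 0 | i < N.+1]
        = f N
    & exists d : nat, forall N, (msize (f N) <= d)%N].

(* A filling of the diagram mu is given by its row reading word w. *)
Definition schur (mu : seq nat) : family := fun N =>
  \sum_(w : (sumn mu).-tuple 'I_N | semistandard (reshape mu (map val w)))
    \prod_(x <- w) 'X_x.

Definition hsym (n : nat) : family := schur [:: n].

Definition prod_family (k : nat) (f : 'I_k -> family) : family :=
  fun N => \prod_(i < k) f i N.

(* The power sum p_r. *)
Definition psum (r : nat) : family := fun N => \sum_(i < N) 'X_i ^+ r.

(* p_r[g]: every variable of g is raised to the power r. *)
Definition psum_plethysm (r : nat) (g : family) : family :=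
  fun N => g N \mPo [tuple 'X_i ^+ r | i < N].

(* P expresses f as a polynomial in the power sums p_1, ..., p_d. *)
Definition is_psum_expansion (f : family)
    (P : {d : nat & {mpoly rat[d]}}) : Prop :=
  forall N, f N = projT2 P \mPo [tuple psum r.+1 N | r < projT1 P].

(* Every symmetric function f has a power sum expansion, unique up to adding
   variables that do not occur in it, and f[g] is obtained from it by replacing
   each p_r with p_r[g]. *)
Definition plethysm (f g : family) : family := fun N =>
  let P := epsilon (inhabits (existT (fun d => {mpoly rat[d]}) 0%N 0))
                   (is_psum_expansion f) in
  projT2 P \mPo [tuple psum_plethysm r.+1 g N | r < projT1 P].

(** * Type attributions and Kronecker maps *)

(* A type attribution is a function on the tableaux of content (n)^m, n >= 1;
   here it is extended by irrelevant values to all lists of rows. *)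
Definition type_attribution (m : nat) (type : tableau -> SYT m) : Prop :=
  forall (n : nat) (t : SYT m), (0 < n)%N -> forall N,
    plethysm (schur (shape t)) (hsym n) N
    = \sum_(T : SSYT (nseq m n) | type T == t) schur (shape T) N.

Definition Kronecker_map (m k : nat) (F : {ffun 'I_k -> SYT m} -> SYT m) : Prop :=
  forall f : 'I_k -> family, (forall i, symmetric_function (f i)) ->
  forall (t : SYT m) N,
    plethysm (schur (shape t)) (prod_family f) N
    = \sum_(u : {ffun 'I_k -> SYT m} | F u == t)
        \prod_(i < k) plethysm (schur (shape (u i))) (f i) N.

Definition composed_type (m k : nat) (type : tableau -> SYT m)
    (F : {ffun 'I_k -> SYT m} -> SYT m) (T : tableau) : SYT m :=
  F [ffun i : 'I_k => type (Dec m i T)].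

(* Main.v *)
Require Import Defs.
From mathcomp Require Import all_boot all_order all_algebra.
From mathcomp Require Import perm zify.

(* A semistandard tableau is a path of partitions, each step adding a horizontal
   strip (the cells of one letter). A jeu de taquin slide replaces every partition of
   the path by the result of a Bender-Knuth move, so rectification of a skew tableau
   S is tableau switching of S with the tableau Y_mu of its inner shape mu. Switching
   is an involution preserving the lattice word condition, and Y_mu is the only
   lattice tableau of its shape, so the skew tableaux of inner shape mu with
   rectification U correspond to the lattice skew tableaux of content mu and inner
   shape nu = shape U: the sum of s_(outer shape) over this fibre depends on nu only.
   The Pieri rule, proved with the local rule of the Robinson-Schensted-Knuth
   correspondence, then forces this sum to be s_mu s_nu. Applied to the blocks of
   letters of a tableau of content lam^m, this turns the products of Schur functions
   in the definition of a Kronecker map into sums over tableaux with prescribed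
   types of their components. *)

Set Implicit Arguments.
Unset Strict Implicit.
Unset Printing Implicit Defensive.

Import GRing.Theory.

(** Jeu de taquin moves single boxes, switching moves whole strips. The two meet because every slide
    enters the lowest inner corner: the cells of Y_mu disappear from its last row, right to left, so
    each slide is the sweep of one cell of the last strip of the row path. On the numbers of entries
    up to a given level in each row, the passage of the hole acts as the toggle of a one-cell strip.
    Shapes are compared through their parts, so toggles, ballot conditions and the Pieri bijection
    all reduce to linear arithmetic with minima and maxima.

    Schur functions are handled as polynomials in n elements of a commutative ring, built one letter
    at a time: the Pieri rule then goes by induction on n, and setting a variable to 0 is the same
    formula at other values. Plethysm enters through the two hypotheses alone; applying the
    Kronecker map requires each h_r to be a symmetric function in the sense of the definitions,
    which is the reason for the closing results on permutation, restriction and degree. *)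

Local Notation part := (nth 0).

(** * Partitions and horizontal strips *)

Lemma part_le mu i : is_partition mu -> part mu i.+1 <= part mu i.
Proof.
case/andP=> /(sortedP 0) mu_s _; case: (ltnP i.+1 (size mu)) => [/mu_s //|le].
by rewrite [X in X <= _]nth_default.
Qed.

Lemma part_pos mu i : is_partition mu -> (0 < part mu i) = (i < size mu).
Proof.
case/andP=> _ mu0; case: (ltnP i (size mu)) => [lt|le]; last by rewrite (nth_default 0 le).
by rewrite lt0n; apply: contra mu0 => /eqP <-; rewrite mem_nth.
Qed.

Lemma part_inj mu la :
  is_partition mu -> is_partition la -> part mu =1 part la -> mu = la.
Proof.
move=> pmu pla eq_p; apply: (@eq_from_nth _ 0) => //.
have h a b : is_partition a -> is_partition b -> part a =1 part b ->
    size a <= size b.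
  by move=> pa pb e; rewrite leqNgt -(part_pos _ pa) e part_pos // ltnn.
by apply/eqP; rewrite eqn_leq !h.
Qed.

(** Partitions carry no zero parts, so a decreasing function is cut at its first zero; [n] only
    bounds the search for that zero. *)
Definition mkpart n (f : nat -> nat) : seq nat :=
  mkseq f (find (fun i => f i == 0) (iota 0 n)).

Section Mkpart.
Variables (n : nat) (f : nat -> nat).
Hypotheses (f_decr : forall i, f i.+1 <= f i) (fn0 : f n = 0).

Let f_geq i j : i <= j -> f j <= f i.
Proof.
move=> /subnK <-; elim: (j - i) => //= k IH.
by apply: leq_trans IH; rewrite addSn.
Qed.

Let k := find (fun i => f i == 0) (iota 0 n).

Let fk0 : f k = 0.
Proof.
have kn : k <= n by rewrite -[n in _ <= n](size_iota 0) find_size.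
case: (ltnP k n) => [lt|ge]; last by rewrite (_ : k = n) //; lia.
have := @nth_find _ 0 (fun i => f i == 0) (iota 0 n).
by rewrite has_find size_iota nth_iota // => /(_ lt) /eqP.
Qed.

Lemma part_mkpart i : part (mkpart n f) i = f i.
Proof.
rewrite /mkpart -/k; case: (ltnP i k) => [lt|ge]; first by rewrite nth_mkseq.
by rewrite nth_default ?size_mkseq //; have := f_geq ge; lia.
Qed.

Lemma mkpart_partition : is_partition (mkpart n f).
Proof.
apply/andP; split.
  apply/(sortedP 0)=> i _; rewrite !part_mkpart; exact: f_decr.
apply/negP=> /mapP[i]; rewrite mem_iota /= add0n => lt.
have kn : k <= n by rewrite -[n in _ <= n](size_iota 0) find_size.
have := @before_find _ 0 (fun i => f i == 0) (iota 0 n) i lt.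
by rewrite nth_iota ?add0n; lia.
Qed.

End Mkpart.

Lemma sumn_part n mu : size mu <= n -> sumn mu = \sum_(i < n) part mu i.
Proof.
elim: mu n => [|a mu IH] [|n] //= le; first by rewrite big_ord0.
  by rewrite big1 // => i _; rewrite nth_default.
by rewrite big_ord_recl (IH n).
Qed.

Definition prefix_sum mu j := \sum_(i < j) part mu i.

Lemma prefix_sum0 mu : prefix_sum mu 0 = 0.
Proof. exact: big_ord0. Qed.

Lemma prefix_sumS mu j : prefix_sum mu j.+1 = prefix_sum mu j + part mu j.
Proof. exact: big_ord_recr. Qed.

Lemma sumn_prefix n mu : size mu <= n -> sumn mu = prefix_sum mu n.
Proof. exact: sumn_part. Qed.

Lemma size_part_le mu : is_partition mu -> size mu <= sumn mu.
Proof.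
move=> /andP[_]; elim: mu => //= a mu IH.
by rewrite inE negb_or => /andP[a0 /IH]; lia.
Qed.

(** Interlacing of parts: la/mu has at most one cell in each column. Parts beyond both lengths
    vanish, which makes the test finite. *)
Definition hstrip (mu la : seq nat) : bool :=
  [&& is_partition mu, is_partition la &
      all (fun i => part la i.+1 <= part mu i <= part la i)
        (iota 0 (maxn (size mu) (size la)))].

Lemma hstripP mu la :
  reflect [/\ is_partition mu, is_partition la &
              forall i, part la i.+1 <= part mu i <= part la i]
          (hstrip mu la).
Proof.
apply: (iffP and3P) => -[pmu pla h]; split=> //.
  move=> i; case: (ltnP i (maxn (size mu) (size la))) => [lt|ge].
    by apply: (allP h); rewrite mem_iota.
  by rewrite !nth_default //; lia.
by apply/allP=> i _.
Qed.

Lemma hstrip_partl mu la : hstrip mu la -> is_partition mu.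
Proof. by case/hstripP. Qed.

Lemma hstrip_partr mu la : hstrip mu la -> is_partition la.
Proof. by case/hstripP. Qed.

Lemma hstrip_size mu la : hstrip mu la -> size mu <= size la.
Proof.
case/hstripP=> pmu pla h; rewrite leqNgt -part_pos //.
by have := h (size la); rewrite (@nth_default _ 0 la (size la)) //; lia.
Qed.

Lemma hstrip_sumn mu la : hstrip mu la -> sumn mu <= sumn la.
Proof.
move=> h; rewrite (sumn_part (hstrip_size h)) (sumn_part (leqnn _)).
by case/hstripP: h => _ _ h; apply: leq_sum => i _; case/andP: (h i).
Qed.

Lemma hstrip_refl mu : is_partition mu -> hstrip mu mu.
Proof. by move=> pmu; apply/hstripP; split=> // i; rewrite part_le /=. Qed.

(** * Toggles *)

(* Bender-Knuth move of the middle partition of a chain rho, la, ka of two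
   horizontal strips; it exchanges the sizes of the two strips. *)
Definition tog_part (rho la ka : seq nat) (i : nat) : nat :=
  (if i is i'.+1 then minn (part ka i) (part rho i') else part ka 0)
  + maxn (part ka i.+1) (part rho i) - part la i.

Definition tog (rho la ka : seq nat) : seq nat :=
  mkpart (size ka) (tog_part rho la ka).

Section Toggle.
Variables rho la ka : seq nat.
Hypotheses (h1 : hstrip rho la) (h2 : hstrip la ka).

Let hs1 i : part la i.+1 <= part rho i <= part la i.
Proof. by case/hstripP: h1. Qed.
Let hs2 i : part ka i.+1 <= part la i <= part ka i.
Proof. by case/hstripP: h2. Qed.

(** These bounds are the interval left to the i-th part by interlacing with [rho] and [ka]. It
    contains the part of [la], and [tog_part] is the reflection of that part in the interval. *)
Lemma tog_part_bounds i :
  maxn (part ka i.+1) (part rho i) <= tog_part rho la ka i /\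
  tog_part rho la ka i <=
    if i is i'.+1 then minn (part ka i) (part rho i') else part ka 0.
Proof.
rewrite /tog_part; case: i => [|i].
  move: (hs1 0) (hs2 0) (hs2 1); lia.
move: (hs1 i.+1) (hs1 i) (hs2 i.+1) (hs2 i) (hs2 i.+2); lia.
Qed.

Let tog_decr i : tog_part rho la ka i.+1 <= tog_part rho la ka i.
Proof.
have [_ /= up] := tog_part_bounds i.+1; have [lo _] := tog_part_bounds i; lia.
Qed.

Let tog0 : tog_part rho la ka (size ka) = 0.
Proof.
have [_ up] := tog_part_bounds (size ka).
have ka0 := @nth_default _ 0 ka (size ka) (leqnn _).
by case: (size ka) up ka0 => [|n] /=; lia.
Qed.

Lemma part_tog i : part (tog rho la ka) i = tog_part rho la ka i.
Proof. exact: part_mkpart. Qed.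

Lemma tog_partition : is_partition (tog rho la ka).
Proof. exact: mkpart_partition. Qed.

Lemma tog_hstripl : hstrip rho (tog rho la ka).
Proof.
apply/hstripP; split; [exact: hstrip_partl h1 | exact: tog_partition |] => i.
rewrite !part_tog; have [_ /= up] := tog_part_bounds i.+1.
have [lo _] := tog_part_bounds i; lia.
Qed.

Lemma tog_hstripr : hstrip (tog rho la ka) ka.
Proof.
apply/hstripP; split; [exact: tog_partition | exact: hstrip_partr h2 |] => i.
rewrite !part_tog; have [] := tog_part_bounds i; case: i => [|i] /=; lia.
Qed.

(** Each minimum in a part of the toggle meets the maximum in the preceding part, and the two add up
    to ka_i + rho_(i-1). Only the last maximum stays unpaired; it accounts for the [minn] term. *)
Lemma prefix_tog j :
  prefix_sum (tog rho la ka) j.+1 + prefix_sum la j.+1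
    + minn (part ka j.+1) (part rho j) =
  prefix_sum ka j.+2 + prefix_sum rho j.+1.
Proof.
elim: j => [|j IH].
  rewrite !prefix_sumS !prefix_sum0 part_tog /tog_part.
  move: (hs1 0) (hs2 0) (hs2 1); lia.
rewrite prefix_sumS (prefix_sumS la) (prefix_sumS ka j.+2) (prefix_sumS rho j.+1).
rewrite part_tog /tog_part.
move: (hs1 j.+1) (hs1 j) (hs2 j.+1) (hs2 j) IH; lia.
Qed.

Lemma sumn_tog : sumn (tog rho la ka) + sumn la = sumn rho + sumn ka.
Proof.
have := prefix_tog (size ka); rewrite (@nth_default _ 0 ka (size ka).+1) // min0n addn0.
move: (hstrip_size h1) (hstrip_size h2) (hstrip_size tog_hstripr) => s1 s2 s3.
rewrite -!sumn_prefix; lia.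
Qed.

End Toggle.

Lemma togK rho la ka :
  hstrip rho la -> hstrip la ka -> tog rho (tog rho la ka) ka = la.
Proof.
move=> h1 h2; have h3 := tog_hstripl h1 h2; have h4 := tog_hstripr h1 h2.
apply: part_inj; first exact: tog_partition.
  exact: hstrip_partl h2.
move=> i; rewrite !(part_tog, h3, h4) // /tog_part part_tog // /tog_part.
case/hstripP: h1 => _ _ h1; case/hstripP: h2 => _ _ h2.
case: i => [|i]; first by move: (h1 0) (h2 0) (h2 1); lia.
move: (h1 i.+1) (h1 i) (h2 i.+1) (h2 i) (h2 i.+2); lia.
Qed.

(** * Paths of horizontal strips and tableau switching *)

(** The starting shape [mu] is not listed in [p], so consecutive paths compose by concatenation. The
    sizes of the strips, listed in [c], are the content. *)
Fixpoint hpath (mu : seq nat) (c : seq nat) (p : seq (seq nat)) : bool :=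
  match c, p with
  | [::], [::] => is_partition mu
  | r :: c', la :: p' =>
      [&& hstrip mu la, sumn la == sumn mu + r & hpath la c' p']
  | _, _ => false
  end.

Lemma hpath_size mu c p : hpath mu c p -> size p = size c.
Proof. by elim: c mu p => [|r c IH] mu [|la p] //= /and3P[_ _ /IH->]. Qed.

Lemma hpath_partl mu c p : hpath mu c p -> is_partition mu.
Proof. by case: c p => [|r c] [|la p] //= /and3P[/hstrip_partl]. Qed.

Lemma hpath_partr mu c p : hpath mu c p -> is_partition (last mu p).
Proof. by elim: c mu p => [|r c IH] mu [|la p] //= /and3P[_ _ /IH]. Qed.

Lemma hpath_rcons mu c r p la :
  hpath mu (rcons c r) (rcons p la) =
  [&& hpath mu c p, hstrip (last mu p) la & sumn la == sumn (last mu p) + r].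
Proof.
elim: c mu p => [|r' c IH] mu [|a p] //=; last by rewrite IH !andbA.
- case: (boolP (hstrip _ _)) => [hs|_]; last by rewrite andbF.
  by rewrite (hstrip_partl hs) (hstrip_partr hs) andbT.
- by case: p => [|? ?] /=; rewrite !andbF.
- by case: c {IH} => [|? ?] /=; rewrite !andbF.
Qed.

(* Moves a horizontal strip la/rho through a path p starting at la; the result
   starts at rho, and the strip comes out as (last la p)/(last rho _). *)
Fixpoint sweep (rho la : seq nat) (p : seq (seq nat)) : seq (seq nat) :=
  if p is ka :: p' then
    let si := tog rho la ka in si :: sweep si ka p'
  else [::].

Fixpoint unsweep (rho : seq nat) (q : seq (seq nat)) (ka : seq nat) :
    seq nat * seq (seq nat) :=
  if q is si :: q' then
    let s := unsweep si q' ka in (tog rho si s.1, s.1 :: s.2)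
  else (ka, [::]).

Lemma sweepP rho la r c p :
  hstrip rho la -> sumn la = sumn rho + r -> hpath la c p ->
  [/\ hpath rho c (sweep rho la p),
      hstrip (last rho (sweep rho la p)) (last la p),
      sumn (last la p) = sumn (last rho (sweep rho la p)) + r &
      unsweep rho (sweep rho la p) (last la p) = (la, p)].
Proof.
elim: c rho la p => [|s c IH] rho la [|ka p] //= h1 e1.
  by rewrite (hstrip_partl h1).
case/and3P=> h2 /eqP e2 hp; have e := sumn_tog h1 h2.
have [] := IH _ _ _ (tog_hstripr h1 h2) _ hp; first by lia.
by move=> -> -> -> -> /=; rewrite tog_hstripl // togK //; split=> //; lia.
Qed.

Lemma unsweepP rho r c q ka :
  hpath rho c q -> hstrip (last rho q) ka -> sumn ka = sumn (last rho q) + r ->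
  let s := unsweep rho q ka in
  [/\ hstrip rho s.1, sumn s.1 = sumn rho + r, hpath s.1 c s.2,
      last s.1 s.2 = ka & sweep rho s.1 s.2 = q].
Proof.
elim: c rho q => [|s c IH] rho [|si q] //=.
  by move=> _ h e; rewrite (hstrip_partr h).
case/and3P=> h1 /eqP e1 hq hl el; have [h2 e2 hp lp sp] := IH _ _ hq hl el.
have e := sumn_tog h1 h2.
rewrite tog_hstripl ?tog_hstripr // togK //= hp lp sp.
by split=> //; rewrite ?andbT; lia.
Qed.

(* Tableau switching of consecutive paths a and p starting at rho. The first
   component is p rectified through a. *)
Fixpoint switch (rho : seq nat) (a p : seq (seq nat)) :
    seq (seq nat) * seq (seq nat) :=
  if a is la :: a' then
    let s := switch la a' p in (sweep rho la s.1, last la s.1 :: s.2)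
  else (p, [::]).

Fixpoint unswitch (rho : seq nat) (u x : seq (seq nat)) :
    seq (seq nat) * seq (seq nat) :=
  if x is ka :: x' then
    let s := unsweep rho u ka in
    let s' := unswitch s.1 s.2 x' in (s.1 :: s'.1, s'.2)
  else ([::], u).

(** The strips of [a] are swept through [p] one at a time, the last one first, and each leaves with
    its own size: the two paths exchange places and keep their contents. *)
Lemma switchP rho d c a p :
  hpath rho d a -> hpath (last rho a) c p ->
  let s := switch rho a p in
  [/\ hpath rho c s.1, hpath (last rho s.1) d s.2,
      last (last rho s.1) s.2 = last (last rho a) p &
      unswitch rho s.1 s.2 = (a, p)].
Proof.
elim: d rho a => [|r d IH] rho [|la a] //=.
  by move=> prho hp; rewrite (hpath_partr hp).
case/and3P=> h1 /eqP e1 ha hp; have [hq hx lx ux] := IH _ _ ha hp.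
have [hs hl el us] := sweepP h1 e1 hq.
by rewrite hs hl hx lx us /= ux el eqxx.
Qed.

Lemma unswitchP rho d c u x :
  hpath rho c u -> hpath (last rho u) d x ->
  let s := unswitch rho u x in
  [/\ hpath rho d s.1, hpath (last rho s.1) c s.2,
      last (last rho s.1) s.2 = last (last rho u) x &
      switch rho s.1 s.2 = (u, x)].
Proof.
elim: d rho u x => [|r d IH] rho u [|ka x] //=.
  by move=> hu _; rewrite (hpath_partl hu).
move=> hu /and3P[h1 /eqP e1 hx].
have [hs es hq lq us] := unsweepP hu h1 e1.
rewrite -lq in hx.
have [ha hp lp sx] := IH _ _ _ hq hx.
by rewrite hs es eqxx ha hp lp sx /= us lq.
Qed.

(** Isolates the strip that is swept first. For a row path this is the last row, the one that jeu de
    taquin empties first. *)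
Lemma switch_rcons rho a la p :
  (switch rho (rcons a la) p).1 = (switch rho a (sweep (last rho a) la p)).1.
Proof. by elim: a rho => //= b a IH rho; rewrite IH. Qed.

(** * Ballot paths *)

(* In every row prefix, the strip ka2/ka1 has at most as many cells as the strip
   ka1/ka0 has in the strictly shorter row prefix; in terms of tableaux, the
   reverse reading word is a lattice word in the two letters. *)
Definition bal3 (ka0 ka1 ka2 : seq nat) : Prop := forall j,
  prefix_sum ka2 j.+1 + prefix_sum ka0 j <=
  prefix_sum ka1 j.+1 + prefix_sum ka1 j.

Fixpoint ballot (rho : seq nat) (p : seq (seq nat)) : Prop :=
  match p with
  | a :: ((b :: _) as p') => bal3 rho a b /\ ballot a p'
  | _ => True
  end.

(** The strip si/rho is moved out past two consecutive strips, and their ballot condition is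
    unchanged. [prefix_tog] gives the new prefix sums up to minima; in one direction the inequality
    for a row prefix comes from those for the same and the preceding prefix, in the other from those
    for the same and the following one. *)
Lemma bal3_tog rho si ka1 ka2 :
  hstrip rho si -> hstrip si ka1 -> hstrip ka1 ka2 ->
  let la1 := tog rho si ka1 in
  bal3 rho la1 (tog la1 ka1 ka2) <-> bal3 si ka1 ka2.
Proof.
move=> h1 h2 h3 la1.
have h4 : hstrip la1 ka1 by exact: tog_hstripr.
have E1 := prefix_tog h1 h2; have E2 := prefix_tog h4 h3.
have P1 := part_tog h1 h2; rewrite -/la1 in E1 P1.
have P2 := part_tog h4 h3; set la2 := tog la1 ka1 ka2 in E2 P2 *.
case/hstripP: h1 => _ _ h1; case/hstripP: h2 => _ _ h2.
case/hstripP: h3 => _ _ h3; case/hstripP: h4 => _ _ h4.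
split=> H j.
  case: j => [|j].
    move: (H 0) (E2 0) (E1 0) (P1 0) (P2 0).
    rewrite !prefix_sumS !prefix_sum0 /= /tog_part.
    move: (h1 0) (h2 0) (h3 0) (h4 0) (h2 1) (h3 1); lia.
  move: (H j.+1) (H j) (E1 j) (E2 j.+1) (E2 j) (P1 j) (P1 j.+1); rewrite /tog_part.
  rewrite !prefix_sumS /=.
  move: (h1 j) (h2 j) (h3 j) (h4 j) (h1 j.+1) (h2 j.+1) (h3 j.+1) (h4 j.+1).
  lia.
case: j => [|j].
  move: (H 0) (H 1) (E2 0) (E1 0) (P1 0) (P2 0).
  rewrite !prefix_sumS !prefix_sum0 /= /tog_part.
  move: (h1 0) (h2 0) (h3 0) (h4 0) (h2 1) (h3 1); lia.
move: (H j.+1) (H j.+2) (E1 j) (E2 j.+1) (E2 j) (P1 j.+1); rewrite /tog_part.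
rewrite !prefix_sumS /=.
move: (h1 j) (h2 j) (h3 j) (h4 j) (h1 j.+1) (h2 j.+1) (h3 j.+1) (h4 j.+1).
lia.
Qed.

(** Two consecutive strips are brought back through all of [u]; every shape of [u] contributes one
    instance of [bal3_tog]. *)
Lemma bal3_unsweep rho c u ka1 ka2 :
  hpath rho c u -> hstrip (last rho u) ka1 -> hstrip ka1 ka2 ->
  let s := unsweep rho u ka1 in
  bal3 rho s.1 (unsweep s.1 s.2 ka2).1 <-> bal3 (last rho u) ka1 ka2.
Proof.
elim: c rho u => [|s c IH] rho [|si q] //= /and3P[h1 _ hq] hl hk.
have [r er] : exists r, sumn ka1 = sumn (last si q) + r.
  by exists (sumn ka1 - sumn (last si q)); rewrite subnKC // hstrip_sumn.
have [r' er'] : exists r, sumn ka2 = sumn ka1 + r.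
  by exists (sumn ka2 - sumn ka1); rewrite subnKC // hstrip_sumn.
have [h2 _ h3 e3 _] := unsweepP hq hl er; rewrite -e3 in hk er'.
have [h4 _ _ _ _] := unsweepP h3 hk er'.
by have := bal3_tog h1 h2 h4; have := IH _ _ hq hl; rewrite -e3 => /(_ hk); tauto.
Qed.

(** The ballot condition compares consecutive strips only, so it is enough to follow each adjacent
    pair of [x] through the path that it crosses. *)
Lemma ballot_unswitch rho d c u x :
  hpath rho c u -> hpath (last rho u) d x ->
  ballot rho (unswitch rho u x).1 <-> ballot (last rho u) x.
Proof.
elim: d rho u x => [|r d IH] rho u [|ka x] //= hu /and3P[h1 /eqP e1 hx].
have [hs es hq lq us] := unsweepP hu h1 e1.
case: d x IH hx => [|r2 d] [|ka2 x] // IH hx.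
have hx' : hpath (last (unsweep rho u ka).1 (unsweep rho u ka).2) (r2 :: d)
             (ka2 :: x) by rewrite lq.
have := IH _ _ _ hq hx'; rewrite lq.
case/and3P: hx => h2 _ _; have := bal3_unsweep hu h1 h2.
by move=> /=; tauto.
Qed.

Lemma prefix_sum_rcons nu r n :
  prefix_sum (rcons nu r) n = prefix_sum nu n + (if size nu < n then r else 0).
Proof.
elim: n => [|n IH]; first by rewrite !prefix_sum0.
rewrite !prefix_sumS IH nth_rcons ltnS; case: (ltngtP n (size nu)) => [|gt|->].
- lia.
- by rewrite (@nth_default _ 0 nu n) ?(ltnW gt) //; lia.
- by rewrite (@nth_default _ 0 nu (size nu)) //; lia.
Qed.

Lemma prefix_sum_le mu la : (forall i, part mu i <= part la i) ->
  forall n, prefix_sum mu n <= prefix_sum la n.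
Proof. by move=> le n; apply: leq_sum => i _. Qed.

(** The prefix sum hypothesis keeps the strip out of the rows of [nu], and a horizontal strip
    reaches at most one row further: all [r] cells form a new last row. *)
Lemma hstrip_rcons_eq nu la r :
  hstrip nu la -> sumn la = sumn nu + r -> 0 < r ->
  prefix_sum la (size nu) <= prefix_sum nu (size nu) -> la = rcons nu r.
Proof.
move=> h e r0 le; have sz := hstrip_size h.
have [pnu pla hs] := hstripP _ _ h.
have la0 i : size nu < i -> part la i = 0.
  case: i => // i; rewrite ltnS => lt; have := hs i.
  by rewrite (@nth_default _ 0 nu i) //; lia.
have szla : size la <= (size nu).+1.
  by rewrite leqNgt -(part_pos _ pla) la0.
have eqp n : n <= size nu -> prefix_sum la n = prefix_sum nu n.
  move=> len; have {}le : prefix_sum la n <= prefix_sum nu n.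
    move: le; rewrite -(subnK len); elim: (size nu - n) => // k IH.
    by rewrite addSn !prefix_sumS; have := hs (k + n); lia.
  have : prefix_sum nu n <= prefix_sum la n.
    by apply: prefix_sum_le => i; have := hs i; lia.
  lia.
have eqi i : i < size nu -> part la i = part nu i.
  by move=> lt; have := eqp i (ltnW lt); have := eqp _ lt; rewrite !prefix_sumS; lia.
have eqr : part la (size nu) = r.
  have := sumn_prefix szla; have := sumn_prefix (leqnn (size nu)).
  by rewrite prefix_sumS eqp //; lia.
apply: (@eq_from_nth _ 0).
  rewrite size_rcons; apply/eqP; rewrite eqn_leq szla.
  by rewrite -(part_pos _ pla) eqr.
move=> i lt; rewrite nth_rcons; case: (ltngtP i (size nu)) => [lti|gti|->] //.
  exact: eqi.
exact: la0.
Qed.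

(* For nu = [::], the path of the tableau Y_c whose i-th row consists of i's. *)
Fixpoint row_path (nu c : seq nat) : seq (seq nat) :=
  if c is r :: c' then rcons nu r :: row_path (rcons nu r) c' else [::].

Lemma row_path_rcons nu c r :
  row_path nu (rcons c r) = rcons (row_path nu c) (rcons (nu ++ c) r).
Proof.
by elim: c nu => [|s c IH] nu /=; rewrite ?cats0 // IH cat_rcons.
Qed.

Lemma last_row_path nu c : last nu (row_path nu c) = nu ++ c.
Proof. by elim: c nu => [|s c IH] nu /=; rewrite ?cats0 // IH cat_rcons. Qed.

Lemma is_partition_rcons nu r :
  is_partition (rcons nu r) ->
  [/\ is_partition nu, 0 < r, nu = [::] \/ r <= last 0 nu
    & hstrip nu (rcons nu r)].
Proof.
move=> pr; have /andP[so no0] := pr.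
have pnu : is_partition nu.
  apply/andP; split; last by move: no0; rewrite mem_rcons inE negb_or => /andP[].
  by apply: (subseq_sorted _ (subseq_rcons _ _) so) => x y z; rewrite /geq /=; lia.
split=> //.
- by move: no0; rewrite mem_rcons inE negb_or; case: r {pr so}.
- case: nu pnu so {pr no0} => [|a nu] _; first by left.
  by rewrite rcons_cons /= rcons_path => /andP[_]; right.
apply/hstripP; split=> // i; move: (part_le i pr); rewrite !nth_rcons.
case: (ltngtP i (size nu)) => [lt|gt|->].
- case: (ltngtP i.+1 (size nu)) => [lt'|gt'|eq']; try lia.
- by rewrite (@nth_default _ 0 nu i) ?(ltnW gt) //; case: ltngtP; lia.
- by rewrite (@nth_default _ 0 nu (size nu)) //; case: ltngtP; lia.
Qed.

Lemma is_partition_catl nu c : is_partition (nu ++ c) -> is_partition nu.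
Proof.
by elim/last_ind: c => [|c r IH]; rewrite ?cats0 // -rcons_cat => /is_partition_rcons[/IH].
Qed.

Lemma hpath_row_path nu c : is_partition (nu ++ c) -> hpath nu c (row_path nu c).
Proof.
elim: c nu => [|r c IH] nu; rewrite ?cats0 // -cat_rcons => p /=.
rewrite IH // sumn_rcons eqxx !andbT.
by have [] := is_partition_rcons (is_partition_catl p).
Qed.

Lemma ballot_row_path nu c : is_partition (nu ++ c) -> ballot nu (row_path nu c).
Proof.
elim: c nu => [|r [|s c] IH] nu //; rewrite -cat_rcons => p.
split; last exact: IH.
move: p; rewrite -cat_rcons => /is_partition_catl/is_partition_rcons[_ _ [|]].
  by case: (nu).
rewrite last_rcons => le _ j.
rewrite !prefix_sum_rcons !size_rcons !ltnS.
case: (ltnP (size nu) j) => [lt|_]; last by case: leqP; lia.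
by rewrite (ltnW lt); lia.
Qed.

(** Uniqueness of the lattice tableau Y_mu. The hypothesis that the next strip adds nothing to the
    existing rows is what the induction carries; it holds trivially when [nu] is empty. *)
Lemma ballot_eq_row_path nu mu a :
  prefix_sum (head [::] a) (size nu) <= prefix_sum nu (size nu) ->
  0 \notin mu -> hpath nu mu a -> ballot nu a -> a = row_path nu mu.
Proof.
elim: mu nu a => [|r c IH] nu [|la a] //= le.
rewrite inE negb_or eq_sym -lt0n => /andP[r0 c0] /and3P[h /eqP e ha].
have el := hstrip_rcons_eq h e r0 le; rewrite el in ha *.
move=> bal; congr cons; apply: IH => //; last by case: (a) bal => // ? ? [].
case: a ha bal => [|b a]; first by move=> *; rewrite /prefix_sum big1 // => i; rewrite nth_nil.
(* In the row prefix of length [size nu], the strip just added has no cell; hence the following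
   strip has none in the prefix that is one row longer, which is the hypothesis needed next. *)
case: c c0 => // s c _ /and3P[hb _ _] [/(_ (size nu)) + _].
rewrite size_rcons !prefix_sum_rcons ltnn ltnSn /=; lia.
Qed.

(** * Sums over partitions and paths *)

Lemma big_seq_bij (V : nmodType) (I J : eqType) (r1 : seq I) (r2 : seq J)
    (P1 : pred I) (P2 : pred J) (f : I -> J) (g : J -> I)
    (F1 : I -> V) (F2 : J -> V) :
  uniq r1 -> uniq r2 ->
  (forall x, x \in r1 -> P1 x ->
     [/\ f x \in r2, P2 (f x), g (f x) = x & F1 x = F2 (f x)]) ->
  (forall y, y \in r2 -> P2 y -> [/\ g y \in r1, P1 (g y) & f (g y) = y]) ->
  (\sum_(x <- r1 | P1 x) F1 x = \sum_(y <- r2 | P2 y) F2 y)%R.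
Proof.
move=> u1 u2 Hf Hg; rewrite -big_filter -[RHS]big_filter.
have -> : (\sum_(x <- [seq x <- r1 | P1 x]) F1 x =
           \sum_(y <- [seq f x | x <- r1 & P1 x]) F2 y)%R.
  rewrite big_map; apply: eq_big_seq => x.
  by rewrite mem_filter => /andP[Px xr]; case: (Hf x xr Px).
apply/perm_big/uniq_perm; rewrite ?filter_uniq //.
  rewrite map_inj_in_uniq ?filter_uniq // => x y.
  rewrite !mem_filter => /andP[Px xr] /andP[Py yr] e.
  by case: (Hf x xr Px) (Hf y yr Py) => _ _ <- _ [_ _ <- _]; rewrite e.
move=> y; rewrite mem_filter; apply/mapP/andP => [[x]|[Py yr]].
  by rewrite mem_filter => /andP[Px xr] ->; case: (Hf x xr Px).
by case: (Hg y yr Py) => gr Pg e; exists (g y); rewrite ?mem_filter ?Pg.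
Qed.

(** A partition of a number at most [n] has at most [n] parts, each at most [n], so it occurs among
    the values of a finite type. *)
Definition partitions_le n : seq (seq nat) :=
  [seq la <- [seq map val (bseqval t) | t <- enum {: {bseq n of 'I_n.+1}}]
  | is_partition la && (sumn la <= n)].

Lemma mem_partitions_le n la :
  (la \in partitions_le n) = is_partition la && (sumn la <= n).
Proof.
rewrite mem_filter andbC; apply: andb_idl => /andP[pla len].
have sz := leq_trans (size_part_le pla) len.
have small x : x \in la -> x < n.+1.
  move=> xla; rewrite ltnS; apply: leq_trans len.
  by rewrite (perm_sumn (perm_to_rem xla)) leq_addr.
apply/mapP; exists (insub_bseq n [seq inord x | x <- la]).
  by rewrite mem_enum.
have bs k (s : seq k) : size s <= n -> insub_bseq n s = s :> seq _.
  by move=> h; rewrite /insub_bseq insubdK.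
rewrite bs; last by rewrite size_map.
rewrite -map_comp -[LHS]map_id; apply/eq_in_map => x /small lt /=.
by rewrite inordK.
Qed.

Lemma partitions_le_uniq n : uniq (partitions_le n).
Proof.
rewrite filter_uniq // map_inj_uniq ?enum_uniq // => s t /(inj_map val_inj) e.
exact: val_inj.
Qed.

Definition partitions_of n := [seq la <- partitions_le n | sumn la == n].

Lemma mem_partitions_of n la :
  (la \in partitions_of n) = is_partition la && (sumn la == n).
Proof.
by rewrite mem_filter mem_partitions_le andbCA; case: eqP => // ->; rewrite leqnn.
Qed.

Lemma partitions_of_uniq n : uniq (partitions_of n).
Proof. by rewrite filter_uniq // partitions_le_uniq. Qed.

Definition strips mu r := [seq la <- partitions_of (sumn mu + r) | hstrip mu la].

Lemma mem_strips mu r la :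
  (la \in strips mu r) = hstrip mu la && (sumn la == sumn mu + r).
Proof.
rewrite mem_filter mem_partitions_of; case: (boolP (hstrip _ _)) => // h.
by rewrite (hstrip_partr h).
Qed.

Lemma strips_uniq mu r : uniq (strips mu r).
Proof. by rewrite filter_uniq // partitions_of_uniq. Qed.

Fixpoint paths (mu : seq nat) (c : seq nat) : seq (seq (seq nat)) :=
  if c is r :: c' then
    [seq la :: p | la <- strips mu r, p <- paths la c']
  else if is_partition mu then [:: [::]] else [::].

Lemma mem_paths mu c p : (p \in paths mu c) = hpath mu c p.
Proof.
elim: c mu p => [|r c IH] mu p /=; first by case: ifP; case: p.
apply/allpairsPdep/idP => [[la [q [hl hq ->]]]|].
  by rewrite /= -IH hq andbT -mem_strips.
case: p => //= la q /and3P[h e hq]; exists la, q.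
by rewrite mem_strips h e IH.
Qed.

Lemma paths_uniq mu c : uniq (paths mu c).
Proof.
elim: c mu => [|r c IH] mu /=; first by case: ifP.
apply: allpairs_uniq_dep => //; first exact: strips_uniq.
by move=> [a p] [b q] _ _ /= [-> ->].
Qed.

Section PathSums.
Variable V : nmodType.
Implicit Types F : seq (seq nat) -> V.
Local Open Scope ring_scope.

Lemma sum_paths_cat mu c1 c2 F :
  \sum_(p <- paths mu (c1 ++ c2)) F p =
  \sum_(p <- paths mu c1) \sum_(q <- paths (last mu p) c2) F (p ++ q).
Proof.
elim: c1 mu F => [|r c IH] mu F /=.
  case: ifP => [_|np]; first by rewrite big_seq1.
  rewrite big_nil big_seq big1 // => p; rewrite mem_paths => /hpath_partl.
  by rewrite np.
rewrite !big_allpairs_dep /=; apply: eq_bigr => la _; exact: IH.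
Qed.

Lemma sum_paths_rcons mu c r F :
  \sum_(p <- paths mu (rcons c r)) F p =
  \sum_(p <- paths mu c) \sum_(la <- strips (last mu p) r) F (rcons p la).
Proof.
rewrite -cats1 sum_paths_cat; apply: eq_bigr => p _.
rewrite /= big_allpairs_dep /=; apply: eq_big_seq => la.
rewrite mem_strips => /andP[/hstrip_partr pla _].
by rewrite pla big_seq1 cats1.
Qed.

Definition rect_path mu p := (switch [::] (row_path [::] mu) p).1.

Lemma rect_pathP mu c p : hpath mu c p -> hpath [::] c (rect_path mu p).
Proof.
move=> hp; have pmu := hpath_partl hp.
have := @switchP [::] mu c (row_path [::] mu) p.
by rewrite hpath_row_path // last_row_path => /(_ isT hp) [].
Qed.

(* Both fibres are in bijection with the ballot paths of content mu starting at
   the common end point of u and u'. *)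
Lemma sum_rect_path_fibre mu c c' u u' (G : seq nat -> V) :
  is_partition mu -> hpath [::] c u -> hpath [::] c' u' ->
  last [::] u = last [::] u' ->
  \sum_(p <- paths mu c | rect_path mu p == u) G (last mu p) =
  \sum_(p <- paths mu c' | rect_path mu p == u') G (last mu p).
Proof.
move=> pmu; set Y := row_path [::] mu.
have hY : hpath [::] mu Y by apply: hpath_row_path.
have lY : last [::] Y = mu by rewrite last_row_path.
(* Switch [p] with Y_mu, keep the lattice path that comes out, put [v] in place of the rectification
   and switch back. *)
pose move_to v p := (unswitch [::] v (switch [::] Y p).2).2.
have main d d' v v' p : hpath [::] d v -> hpath [::] d' v' ->
    last [::] v = last [::] v' -> hpath mu d p -> rect_path mu p = v ->
    [/\ hpath mu d' (move_to v' p), rect_path mu (move_to v' p) = v',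
        move_to v (move_to v' p) = p & last mu p = last mu (move_to v' p)].
  move=> hv hv' ev hp rp; rewrite -lY in hp.
  have [_ hx lx ux] := switchP hY hp.
  rewrite -/(rect_path mu p) rp in hx lx ux.
  have bx := (ballot_unswitch hv hx).1; rewrite ux ev in bx.
  rewrite ev in hx lx.
  have [ha hq lq sq] := unswitchP hv' hx.
  have ba : ballot [::] (unswitch [::] v' (switch [::] Y p).2).1.
    by apply/(ballot_unswitch hv' hx)/bx; apply: ballot_row_path.
  (* Switching back gives a ballot path of content [mu] starting at the empty shape. By uniqueness
     it is Y_mu again, so the new path starts at [mu] and has rectification [v']. *)
  have ea : (unswitch [::] v' (switch [::] Y p).2).1 = Y.
    apply: ballot_eq_row_path => //; first by rewrite !prefix_sum0.
    by case/andP: pmu.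
  rewrite ea lY -/(move_to v' p) in hq lq sq.
  rewrite /rect_path -/Y sq /=; split=> //.
    by rewrite /move_to sq /= ux.
  by rewrite lq -lY.
move=> hu hu' eu.
apply: (@big_seq_bij _ _ _ _ _ _ _ (move_to u') (move_to u)).
- exact: paths_uniq.
- exact: paths_uniq.
- move=> p; rewrite mem_paths => hp /eqP rp.
  have [h1 h2 h3 h4] := main _ _ _ _ _ hu hu' eu hp rp.
  by rewrite mem_paths h1 h2 eqxx h3 h4.
move=> p; rewrite mem_paths => hp /eqP rp.
have [h1 h2 h3 h4] := main _ _ _ _ _ hu' hu (esym eu) hp rp.
by rewrite mem_paths h1 h2 eqxx h3.
Qed.

(** Every sweep treats its path from left to right, so rectification commutes with the removal of
    the largest letter. *)
Lemma rect_path_rcons mu p la :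
  exists ka, rect_path mu (rcons p la) = rcons (rect_path mu p) ka.
Proof.
have sw rho al q ka : exists ka', sweep rho al (rcons q ka) = rcons (sweep rho al q) ka'.
  elim: q rho al => [|b q IH] rho al /=; first by exists (tog rho al ka).
  by have [ka' ->] := IH (tog rho al b) b; exists ka'.
rewrite /rect_path; move: [::] (row_path _ _) => rho a; elim: a rho => [|b a IH] rho /=.
  by exists la.
by have [ka ->] := IH b; exact: sw.
Qed.

End PathSums.

(** * The Pieri rule *)

Section PieriBijection.
Variables mu s : seq nat.
Hypotheses (pmu : is_partition mu) (ps : is_partition s).

Let lo i := maxn (part mu i) (part s i).
Let hi i := minn (part mu i) (part s i).

Let d1 i : part mu i.+1 <= part mu i. Proof. exact: part_le. Qed.
Let d2 i : part s i.+1 <= part s i. Proof. exact: part_le. Qed.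

(* The local rule of the Robinson-Schensted-Knuth correspondence. *)
Definition rsk_up ka a : seq nat :=
  mkpart (size mu + size s).+1
    (fun i => if i is i'.+1 then lo i + hi i' - part ka i' else lo 0 + a).

Definition rsk_down la : seq nat :=
  mkpart (size mu + size s) (fun i => lo i.+1 + hi i - part la i.+1).

Let lo_nil i : size mu + size s <= i -> lo i = 0.
Proof. by move=> h; rewrite /lo !nth_default //; lia. Qed.

Let hi_nil i : size mu + size s <= i -> hi i = 0.
Proof. by move=> h; rewrite /hi !nth_default //; lia. Qed.

(** In each row [lo] and [hi] add up to the parts of [mu] and [s], so the prefix sums telescope with
    remainder [hi j], which vanishes for large j. *)
Let sumn_rule ka la a : is_partition ka -> is_partition la ->
  part la 0 = lo 0 + a ->
  (forall i, part la i.+1 + part ka i = lo i.+1 + hi i) ->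
  sumn la + sumn ka = sumn mu + sumn s + a.
Proof.
move=> pka pla e0 e.
have H j : prefix_sum la j.+1 + prefix_sum ka j + hi j =
           prefix_sum mu j.+1 + prefix_sum s j.+1 + a.
  elim: j => [|j IH].
    by rewrite !prefix_sumS !prefix_sum0 e0 /lo /hi; lia.
  rewrite (prefix_sumS la) (prefix_sumS ka) (prefix_sumS mu) (prefix_sumS s).
  by move: (e j) IH; rewrite /lo /hi; lia.
have := H (size mu + size s + size la + size ka).
rewrite hi_nil; last by lia.
rewrite -!sumn_prefix; lia.
Qed.

(** Interlacing from below puts ka_i, and interlacing from above la_(i+1), in the same interval from
    [lo i.+1] to [hi i]; the rule reflects one into the other. The first part of [la] has no upper
    bound and absorbs the [a] cells that give [la] its size. *)
Lemma rsk_upP ka r : hstrip ka mu -> hstrip ka s -> sumn s <= sumn ka + r ->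
  let la := rsk_up ka (sumn ka + r - sumn s) in
  [/\ hstrip mu la, hstrip s la, sumn la = sumn mu + r & rsk_down la = ka].
Proof.
move=> hm hs le; set a := sumn ka + r - sumn s => la.
have [pka _ km] := hstripP _ _ hm; have [_ _ ks] := hstripP _ _ hs.
pose f i := if i is i'.+1 then lo i + hi i' - part ka i' else lo 0 + a.
have fd i : f i.+1 <= f i.
  case: i => [|i]; first by move: (km 0) (ks 0); rewrite /f /lo /hi; lia.
  by move: (km i) (ks i) (km i.+1) (ks i.+1); rewrite /f /lo /hi; lia.
have f0 : f (size mu + size s).+1 = 0.
  by rewrite /f lo_nil // hi_nil //; lia.
have lE i : part la i = f i by apply: part_mkpart.
have pla : is_partition la by apply: mkpart_partition.
have e i : part la i.+1 + part ka i = lo i.+1 + hi i.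
  by rewrite lE; move: (km i) (ks i); rewrite /f /lo /hi; lia.
have sz := sumn_rule pka pla (lE 0) e.
split.
- apply/hstripP; split=> // i; move: (lE 0) (e i); case: i => [|i].
    by move: (km 0) (ks 0); rewrite /f /lo /hi; lia.
  by move: (e i) (km i) (ks i) (km i.+1) (ks i.+1); rewrite /f /lo /hi; lia.
- apply/hstripP; split=> // i; move: (lE 0) (e i); case: i => [|i].
    by move: (km 0) (ks 0); rewrite /f /lo /hi; lia.
  by move: (e i) (km i) (ks i) (km i.+1) (ks i.+1); rewrite /f /lo /hi; lia.
- by move: sz; rewrite /a; lia.
apply: part_inj => //.
  apply: mkpart_partition => [i|].
    by move: (e i) (e i.+1) (part_le i pka); lia.
  by rewrite lo_nil ?hi_nil //; lia.
move=> i; rewrite part_mkpart.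
- by move: (e i); lia.
- by move=> j; move: (e j) (e j.+1) (part_le j pka); lia.
by rewrite lo_nil ?hi_nil //; lia.
Qed.

Lemma rsk_downP la r : hstrip mu la -> hstrip s la -> sumn la = sumn mu + r ->
  let ka := rsk_down la in
  [/\ hstrip ka mu, hstrip ka s, sumn s <= sumn ka + r
    & rsk_up ka (sumn ka + r - sumn s) = la].
Proof.
move=> hm hs sz ka.
have [_ pla ml] := hstripP _ _ hm; have [_ _ sl] := hstripP _ _ hs.
pose f i := lo i.+1 + hi i - part la i.+1.
have fd i : f i.+1 <= f i.
  by move: (ml i) (sl i) (ml i.+1) (sl i.+1) (ml i.+2) (sl i.+2); rewrite /f /lo /hi; lia.
have f0 : f (size mu + size s) = 0.
  by rewrite /f lo_nil ?hi_nil //; lia.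
have kE i : part ka i = f i by apply: part_mkpart.
have pka : is_partition ka by apply: mkpart_partition.
have e i : part la i.+1 + part ka i = lo i.+1 + hi i.
  by rewrite kE; move: (ml i) (sl i) (ml i.+1) (sl i.+1); rewrite /f /lo /hi; lia.
have e0 : part la 0 = lo 0 + (part la 0 - lo 0).
  by move: (ml 0) (sl 0); rewrite /lo; lia.
have sz' := sumn_rule pka pla e0 e.
have ea : sumn ka + r - sumn s = part la 0 - lo 0 by lia.
split.
- apply/hstripP; split=> // i.
  by move: (e i) (ml i) (sl i) (ml i.+1) (sl i.+1); rewrite /lo /hi; lia.
- apply/hstripP; split=> // i.
  by move: (e i) (ml i) (sl i) (ml i.+1) (sl i.+1); rewrite /lo /hi; lia.
- lia.
rewrite ea; pose g i := if i is i'.+1 then lo i + hi i' - part ka i'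
                        else lo 0 + (part la 0 - lo 0).
have gE i : g i = part la i.
  by case: i => [|i]; rewrite /g -?e0 //; move: (e i); lia.
apply: part_inj => //.
  apply: mkpart_partition => [i|]; first by rewrite -/(g i.+1) -/(g i) !gE part_le.
  by rewrite lo_nil // hi_nil //; lia.
move=> i; rewrite part_mkpart -/(g i) // => [j|].
  by rewrite -/(g j.+1) -/(g j) !gE part_le.
by rewrite lo_nil // hi_nil //; lia.
Qed.

End PieriBijection.

Section SchurPolynomials.
Local Open Scope ring_scope.
Variables (R : comNzRingType) (x : nat -> R).

(* The Schur polynomial in x_0, ..., x_(n-1), peeling off the largest letter. *)
Fixpoint schur_pol n mu : R :=
  if n is n'.+1 then
    \sum_(s <- partitions_le (sumn mu) | hstrip s mu)
      schur_pol n' s * x n' ^+ (sumn mu - sumn s)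
  else (mu == [::])%:R.

Fixpoint complete_pol n r : R :=
  if n is n'.+1 then \sum_(a < r.+1) complete_pol n' (r - a)%N * x n' ^+ a
  else (r == 0)%:R.

Lemma schur_pol_nil n : schur_pol n [::] = 1.
Proof.
elim: n => [|n IH] //=.
rewrite (eq_bigr (fun s => 1)); last first.
  by move=> s /hstrip_size; case: s => //= _; rewrite IH mul1r.
have e : (hstrip^~ [::]) =1 pred1 [::].
  by move=> s; apply/idP/eqP => [/hstrip_size|->]; [case: s|].
rewrite (eq_bigl _ _ e).
rewrite big_const_seq count_uniq_mem ?partitions_le_uniq // mem_partitions_le /=.
by rewrite addr0.
Qed.

(** A common bound [b] for different shapes [mu] allows these sums to be exchanged with a sum over
    [mu]. *)
Lemma sum_strips_below (V : nmodType) b mu (F : seq nat -> V) :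
  (sumn mu <= b)%N ->
  \sum_(s <- partitions_le (sumn mu) | hstrip s mu) F s =
  \sum_(s <- partitions_le b | hstrip s mu) F s.
Proof.
move=> le; rewrite -big_filter -[RHS]big_filter; apply/perm_big/uniq_perm.
- by rewrite filter_uniq ?partitions_le_uniq.
- by rewrite filter_uniq ?partitions_le_uniq.
move=> s; rewrite 2!(mem_filter (hstrip^~ mu)) !mem_partitions_le.
case: (boolP (hstrip s mu)) => //= h; have := hstrip_sumn h.
by move=> les; rewrite les (leq_trans les le).
Qed.

(** Both sides are expanded in the last variable. The coefficient of the Schur polynomial of [s]
    counts, on the left, the shapes [la] above both [mu] and [s] and, on the right, the shapes [k]
    below both; the local rule matches them. *)
Lemma schur_pol_pieri n mu r : is_partition mu ->
  \sum_(la <- strips mu r) schur_pol n la = schur_pol n mu * complete_pol n r.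
Proof.
move=> pmu; elim: n mu r pmu => [|n IH] mu r pmu.
  rewrite /= -natrM mulnb -(_ : ([::] \in strips mu r) = (mu == [::]) && (r == 0%N)).
    rewrite -count_uniq_mem ?strips_uniq // -sum1_count natr_sum [RHS]big_mkcond.
    by apply: eq_bigr => la _ /=; case: eqP.
  rewrite mem_strips; apply/andP/andP => [[/hstrip_size]|[/eqP-> /eqP->]] //.
  by case: mu {pmu} => //= _ /eqP; rewrite add0n => <-.
set b := (sumn mu + r)%N.
(* The exponent depends on [s] alone, since every [la] has size [b]. *)
pose A s := schur_pol n s * x n ^+ (b - sumn s).
have -> : \sum_(la <- strips mu r) schur_pol n.+1 la =
    \sum_(s <- partitions_le b)
      \sum_(la <- strips mu r | hstrip s la) A s.
  rewrite [RHS](exchange_big_dep xpredT) //=; apply: eq_big_seq => la.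
  rewrite mem_strips => /andP[_ /eqP e].
  by rewrite (@sum_strips_below _ b) ?e //; apply: eq_bigr => s _; rewrite /A -/b.
have -> : schur_pol n.+1 mu * complete_pol n.+1 r =
    \sum_(s <- partitions_le b)
      \sum_(k <- partitions_le b | [&& hstrip k mu, hstrip k s
                                     & (sumn s <= sumn k + r)%N]) A s.
  rewrite [RHS](exchange_big_dep (hstrip^~ mu)) /=; last by move=> ? ? _ /and3P[].
  rewrite (@sum_strips_below _ b) ?leq_addr // mulr_suml; apply: eq_bigr => k hk.
  have lek := hstrip_sumn hk.
  (* The class of [s] is the exponent of the last variable taken from the complete polynomial. The
     strip s/k then has size r - a, and the induction hypothesis applies to it. *)
  rewrite hk /= (partition_big (fun s => inord (sumn k + r - sumn s) : 'I_r.+1)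
    xpredT) //= mulr_sumr; apply: eq_bigr => a _.
  rewrite mulrACA -IH ?(hstrip_partl hk) // mulr_suml -exprD.
  rewrite -[RHS]big_filter; apply/esym.
  rewrite (eq_big_seq (fun s => schur_pol n s * x n ^+ (sumn mu - sumn k + a))).
    apply/perm_big/uniq_perm.
    - exact/filter_uniq/partitions_le_uniq.
    - exact: strips_uniq.
    move=> s; rewrite (mem_filter (hstrip k)) mem_partitions_of mem_filter mem_partitions_le.
    case: (boolP (hstrip k s)) => //= h; have les := hstrip_sumn h.
    rewrite (hstrip_partr h) /= -val_eqE /=; have ar := ltn_ord a.
    by rewrite inordK; [apply/idP/idP; rewrite /b; lia|lia].
  move=> s; rewrite mem_filter => /andP[/andP[/andP[hks le] /eqP <-] _].
  rewrite /A; congr (_ * x n ^+ _).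
  by rewrite inordK; have := hstrip_sumn hks; rewrite /b; lia.
apply: eq_big_seq => s; rewrite mem_partitions_le => /andP[ps _].
apply: (@big_seq_bij _ _ _ _ _ _ _ (rsk_down mu s)
          (fun k => rsk_up mu s k (sumn k + r - sumn s))).
- exact: strips_uniq.
- exact: partitions_le_uniq.
- move=> la; rewrite mem_strips => /andP[h1 /eqP e] h2.
  have [k1 k2 k3 k4] := rsk_downP pmu ps h1 h2 e.
  split=> //; last by rewrite k1 k2.
  rewrite mem_partitions_le (hstrip_partl k1) /=.
  by apply: leq_trans (hstrip_sumn k1) _; rewrite leq_addr.
move=> k _ /and3P[k1 k2 k3]; have [h1 h2 h3 h4] := rsk_upP pmu ps k1 k2 k3.
by rewrite mem_strips h1 h3 eqxx.
Qed.

End SchurPolynomials.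

(** * The Littlewood-Richardson rule *)

Section LittlewoodRichardson.
Local Open Scope ring_scope.
Variables (R : comNzRingType) (x : nat -> R) (n : nat).
Local Notation S := (schur_pol x n).
Local Notation H := (complete_pol x n).

Definition rect_sum mu c u : R :=
  \sum_(p <- paths mu c | rect_path mu p == u) S (last mu p).

Lemma sum_uniq_eq (V : nmodType) (I : eqType) (r : seq I) (i : I) (c : V) :
  uniq r -> i \in r -> \sum_(j <- r | j == i) c = c.
Proof.
move=> ur ir; rewrite -big_filter (@perm_big _ _ _ _ _ [:: i]) ?big_seq1 //.
apply: uniq_perm; rewrite ?filter_uniq // => j.
by rewrite mem_filter inE; case: eqP => // ->.
Qed.

(** Each extension of a path over [u] by a strip of size [r] rectifies to an extension of [u] by
    exactly one shape [nu]. Summed over all [nu], the extensions are therefore unrestricted, and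
    Pieri evaluates them. *)
Lemma rect_sum_rcons mu c u r : is_partition mu -> hpath [::] c u ->
  \sum_(nu <- strips (last [::] u) r) rect_sum mu (rcons c r) (rcons u nu) =
  rect_sum mu c u * H r.
Proof.
move=> pmu hu; rewrite /rect_sum mulr_suml.
under [LHS]eq_bigr => nu _ do rewrite big_mkcond sum_paths_rcons.
rewrite exchange_big [RHS]big_mkcond; apply: eq_big_seq => p.
rewrite mem_paths => hp; rewrite exchange_big /=.
case: eqP => [rp|nrp]; last first.
  rewrite big1 // => la _; rewrite big1 // => nu _.
  have [ka ->] := rect_path_rcons mu p la.
  by case: eqP => // /rcons_inj[/nrp].
rewrite -schur_pol_pieri ?(hpath_partr hp) //; apply: eq_big_seq => la.
rewrite mem_strips last_rcons => hla.
have [ka e] := rect_path_rcons mu p la.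
have : hpath [::] (rcons c r) (rect_path mu (rcons p la)).
  by apply: rect_pathP; rewrite hpath_rcons hp.
rewrite e rp hpath_rcons => /and3P[_ h1 h2].
rewrite -big_mkcond (eq_bigl (pred1 ka)) => [|nu]; last first.
  by rewrite /= eq_sym eqseq_rcons eqxx.
by rewrite sum_uniq_eq ?strips_uniq // mem_strips h1.
Qed.

(* Pieri determines s_mu s_nu by induction on the number of rows of nu and on the
   length of the last one: if nu = (nu', r), every other shape obtained from nu' by
   adding a strip of size r has a shorter last row. *)
Lemma rect_sum_row_path mu nu : is_partition mu -> is_partition nu ->
  rect_sum mu nu (row_path [::] nu) = S mu * S nu.
Proof.
move=> pmu.
suff aux l r : (size nu <= l)%N -> (part nu l.-1 <= r)%N -> is_partition nu ->
    rect_sum mu nu (row_path [::] nu) = S mu * S nu.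
  exact: (aux _ _ (leqnn _) (leqnn _)).
elim: l nu r => [|l IHl] nu r.
  rewrite leqn0 => /nilP -> _ _.
  rewrite schur_pol_nil mulr1 /rect_sum /= pmu big_mkcond big_seq1.
  by have := @rect_pathP mu [::] [::] pmu; case: (rect_path _ _).
elim: r nu => [|r IHr] nu sz le pnu.
  apply: (IHl _ (part nu l.-1)) => //; rewrite leqNgt -(part_pos _ pnu).
  by move: le => /=; lia.
case: (leqP (part nu l) r) => [le'|gt]; first exact: IHr.
have eqr : part nu l = r.+1 by move: le gt => /=; lia.
have {}sz : size nu = l.+1.
  by apply/eqP; rewrite eqn_leq sz -(part_pos _ pnu) eqr.
case/lastP: nu sz eqr pnu {le gt} => // nu s; rewrite size_rcons => -[sz].
rewrite nth_rcons sz ltnn eqxx => -> {s} pnu.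
have [pnu' _ _ hnu] := is_partition_rcons pnu.
have hrow := hpath_row_path (pnu' : is_partition ([::] ++ nu)).
have erow := last_row_path [::] nu.
have eL : rect_sum mu nu (row_path [::] nu) = S mu * S nu.
  by apply: (IHl _ (part nu l.-1)); rewrite ?sz.
have := rect_sum_rcons r.+1 pmu hrow; rewrite eL -mulrA -schur_pol_pieri //.
rewrite mulr_sumr erow.
have nu_in : rcons nu r.+1 \in strips nu r.+1.
  by rewrite mem_strips hnu sumn_rcons eqxx.
rewrite !(bigD1_seq _ nu_in) ?strips_uniq //=.
rewrite row_path_rcons /= => e; apply: (addIr _ (etrans e _)); congr (_ + _).
apply: esym; rewrite big_seq_cond [RHS]big_seq_cond; apply: eq_bigr => la.
rewrite mem_strips => /andP[/andP[hla /eqP ela] nla].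
have pla := hstrip_partr hla.
have hp : hpath [::] (rcons nu r.+1) (rcons (row_path [::] nu) la).
  by rewrite hpath_rcons hrow erow hla ela eqxx.
(* The path to [la] through [nu] has the same end as the row path of [la], so their fibres give the
   same sum. *)
transitivity (rect_sum mu la (row_path [::] la)).
  apply: sum_rect_path_fibre => //; first exact: hpath_row_path.
  by rewrite last_rcons last_row_path.
have szla : (size la <= l.+1)%N.
  rewrite leqNgt -(part_pos _ pla).
  have [_ _ /(_ l)] := hstripP _ _ hla; rewrite (@nth_default _ 0%N nu l) ?sz //.
  by lia.
(* A last part larger than [r] would contain all r + 1 new cells, and [la] would be the excluded
   shape [rcons nu r.+1]. *)
apply: IHr => //=; rewrite leqNgt; apply/negP => gt.
case/eqP: nla; apply: (hstrip_rcons_eq hla ela) => //.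
have := sumn_prefix szla; have := sumn_prefix (leqnn (size nu)).
by rewrite prefix_sumS sz; lia.
Qed.

Theorem littlewood_richardson mu c u : is_partition mu -> hpath [::] c u ->
  \sum_(p <- paths mu c | rect_path mu p == u) S (last mu p) =
  S mu * S (last [::] u).
Proof.
move=> pmu hu; rewrite -rect_sum_row_path ?(hpath_partr hu) //.
apply: sum_rect_path_fibre => //; last by rewrite last_row_path.
by apply: hpath_row_path; apply: hpath_partr hu.
Qed.

Lemma littlewood_richardson_pred mu c (Q : pred (seq (seq nat))) :
  is_partition mu ->
  \sum_(p <- paths mu c | Q (rect_path mu p)) S (last mu p) =
  S mu * \sum_(u <- paths [::] c | Q u) S (last [::] u).
Proof.
move=> pmu; rewrite mulr_sumr big_mkcond /=.
transitivity (\sum_(u <- paths [::] c | Q u)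
    \sum_(p <- paths mu c | rect_path mu p == u) S (last mu p)); last first.
  rewrite big_seq_cond [RHS]big_seq_cond; apply: eq_bigr => u.
  by rewrite mem_paths => /andP[hu _]; apply: littlewood_richardson hu.
rewrite (exchange_big_dep xpredT) //=; apply: eq_big_seq => p.
rewrite mem_paths => /rect_pathP hp; case: ifP => Qp.
  rewrite (eq_bigl (pred1 (rect_path mu p))) => [|u]; last first.
    by apply/andP/eqP => [[_ /eqP->]|->].
  by rewrite sum_uniq_eq ?paths_uniq // mem_paths.
by rewrite big_pred0 // => u; apply/negP => /andP[Qu /eqP e]; rewrite e Qu in Qp.
Qed.

(** * Products of several Schur functions by blocks of letters *)

Fixpoint rect_blocks mu (cs : seq (seq nat)) p : seq (seq (seq nat)) :=
  if cs is c :: cs' then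
    let b := take (size c) p in
    rect_path mu b :: rect_blocks (last mu b) cs' (drop (size c) p)
  else [::].

(** Once the later blocks are summed, they leave the Schur function of their starting shape times a
    factor independent of that shape. The block before them can then be summed in the same way. *)
Lemma sum_rect_blocks mu (cs : seq (seq nat)) (Q : nat -> pred (seq (seq nat))) :
  is_partition mu ->
  \sum_(p <- paths mu (flatten cs) |
       all (fun i => Q i (nth [::] (rect_blocks mu cs p) i)) (iota 0 (size cs)))
    S (last mu p) =
  S mu * \prod_(i < size cs)
    \sum_(u <- paths [::] (nth [::] cs i) | Q i u) S (last [::] u).
Proof.
elim: cs mu Q => [|c cs IH] mu Q pmu.
  by rewrite big_ord0 mulr1 /= pmu big_mkcond big_seq1.
rewrite big_ord_recl mulrA -littlewood_richardson_pred // big_mkcond /=.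
rewrite sum_paths_cat [X in _ = X * _]big_mkcond mulr_suml.
apply: eq_big_seq => p; rewrite mem_paths => hp; have szp := hpath_size hp.
under [LHS]eq_bigr => q _ do rewrite take_size_cat // drop_size_cat // last_cat.
case: (Q 0%N _) => /=; last by rewrite big1 ?mul0r.
rewrite -big_mkcond /= -(IH _ (fun i => Q i.+1)) ?(hpath_partr hp) //.
by apply: eq_bigl => q; rewrite -[1%N]/(1 + 0)%N iotaDl all_map.
Qed.

End LittlewoodRichardson.

(** * Tableaux as paths *)

Definition lt_count y (r : seq nat) := count (fun v => v < y) r.

(** The entries less than [y] form a prefix of a weakly increasing row, so counts and entries
    determine each other. *)
Lemma sorted_lt_count y r j : sorted leq r ->
  (j < lt_count y r) = (j < size r) && (nth 0 r j < y).
Proof.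
rewrite /lt_count; elim: r j => [|a r IH] j //= sr.
have {}IH := IH _ (path_sorted sr).
case: (ltnP a y) => [lt|ge].
  by case: j => [|j] /=; [rewrite lt | rewrite add1n !ltnS IH].
have far v : v \in r -> y <= v.
  by move=> vr; apply: leq_trans ge _; move/(order_path_min leq_trans)/allP: sr; apply.
rewrite (@eq_in_count _ _ pred0) ?count_pred0 => [|v /far]; last first.
  by rewrite ltnNge => ->.
apply/esym/negP => /andP[]; case: j => [|j] /= lt; first by rewrite ltnNge ge.
by rewrite ltnNge far // mem_nth.
Qed.

Lemma lt_count_le y y' r : y <= y' -> lt_count y r <= lt_count y' r.
Proof. by move=> le; apply: sub_count => v /leq_trans; apply. Qed.

Lemma lt_count_all n r : all (fun v => v < n) r -> lt_count n r = size r.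
Proof. by rewrite all_count => /eqP. Qed.

Lemma lt_countS y r : lt_count y.+1 r = lt_count y r + count_mem y r.
Proof.
elim: r => //= a r IH; rewrite /lt_count /= -!/(lt_count _ _) IH ltnS.
by case: ltngtP; lia.
Qed.

(** Strict columns in the form of interlacing: the letters up to [y] in the lower row lie under
    letters less than [y]. This is the horizontal strip condition between successive shapes. *)
Lemma column_strictP r1 r2 : sorted leq r1 -> sorted leq r2 ->
  size r2 <= size r1 ->
  reflect (forall y, lt_count y.+1 r2 <= lt_count y r1) (column_strict r1 r2).
Proof.
move=> s1 s2 le; apply: (iffP allP) => [h y|h j].
  rewrite leqNgt; apply/negP => lt; have := sorted_lt_count y (lt_count y r1) s1.
  rewrite ltnn => /esym/negP; apply.
  move: lt; rewrite sorted_lt_count // => /andP[lt lty].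
  rewrite (leq_trans lt le) /=; move: lty; rewrite ltnS; apply: leq_trans.
  by apply: h; rewrite mem_iota.
rewrite mem_iota add0n /= => lt.
have : j < lt_count (nth 0 r2 j).+1 r2 by rewrite sorted_lt_count // lt ltnSn.
by move=> /leq_trans/(_ (h _)); rewrite sorted_lt_count // => /andP[].
Qed.

Lemma eq_sorted_lt_count n r1 r2 : sorted leq r1 -> sorted leq r2 ->
  all (fun v => v < n) r1 -> all (fun v => v < n) r2 ->
  (forall y, y <= n -> lt_count y r1 = lt_count y r2) -> r1 = r2.
Proof.
move=> s1 s2 a1 a2 e.
have sz : size r1 = size r2 by rewrite -(lt_count_all a1) e // lt_count_all.
apply: (@eq_from_nth _ 0) => // j lt; have lt' := lt; rewrite sz in lt'.
have h y : y <= n -> (nth 0 r1 j < y) = (nth 0 r2 j < y).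
  move=> /e ey; have := sorted_lt_count y j s1; have := sorted_lt_count y j s2.
  by rewrite lt lt' ey /= => <- <-.
have n1 : nth 0 r1 j < n by apply: (allP a1); rewrite mem_nth.
have n2 : nth 0 r2 j < n by apply: (allP a2); rewrite mem_nth.
have := h _ n1; have := h _ n2; rewrite !ltnSn; lia.
Qed.

Lemma all_flatten (A : Type) (a : pred A) (ss : seq (seq A)) :
  all a (flatten ss) = all (all a) ss.
Proof. by elim: ss => //= s ss IH; rewrite all_cat IH. Qed.

Definition shape_lt (T : tableau) y : seq nat :=
  mkpart (size T) (fun l => lt_count y (nth [::] T l)).

Definition path_of n (T : tableau) := mkseq (fun y => shape_lt T y.+1) n.

Lemma nth_path_of n T y : y < n -> nth [::] (path_of n T) y = shape_lt T y.+1.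
Proof. exact: nth_mkseq. Qed.

Section SemistandardPath.
Variable T : tableau.
Hypothesis ssT : semistandard T.

Let row l := nth [::] T l.

Lemma semistandard_row l : sorted leq (row l).
Proof.
case/and3P: ssT => _ /allP rs _; case: (ltnP l (size T)) => [lt|le].
  by apply: rs; rewrite mem_nth.
by rewrite /row nth_default.
Qed.

Let row_size l : size (row l) = part (shape T) l.
Proof.
case: (ltnP l (size T)) => [lt|le]; first by rewrite (nth_map [::]).
by rewrite /row !nth_default ?size_map.
Qed.

Let pT : is_partition (shape T). Proof. by case/and3P: ssT. Qed.

Lemma semistandard_strip y l : lt_count y.+1 (row l.+1) <= lt_count y (row l).
Proof.
case/and3P: ssT => _ _ /(sortedP [::]) cs.
case: (ltnP l.+1 (size T)) => [/cs|le]; last by rewrite /row nth_default.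
move/column_strictP; apply; rewrite ?semistandard_row //.
by rewrite !row_size part_le.
Qed.

Let decr y l : lt_count y (row l.+1) <= lt_count y (row l).
Proof. exact: leq_trans (lt_count_le _ (leqnSn y)) (semistandard_strip _ _). Qed.

Let row_nil y : lt_count y (row (size T)) = 0.
Proof. by rewrite /row nth_default. Qed.

Lemma part_shape_lt y l : part (shape_lt T y) l = lt_count y (row l).
Proof. exact: part_mkpart. Qed.

Lemma shape_lt_partition y : is_partition (shape_lt T y).
Proof. exact: mkpart_partition. Qed.

Lemma shape_lt_strip y : hstrip (shape_lt T y) (shape_lt T y.+1).
Proof.
apply/hstripP; split=> [||l]; try exact: shape_lt_partition.
by rewrite !part_shape_lt semistandard_strip lt_count_le.
Qed.

Lemma shape_lt0 : shape_lt T 0 = [::].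
Proof.
apply: part_inj => // [|l]; first exact: shape_lt_partition.
by rewrite part_shape_lt nth_nil /lt_count (eq_count (a2 := pred0)) ?count_pred0.
Qed.

Lemma shape_lt_all n :
  all (fun v => v < n) (flatten T) -> shape_lt T n = shape T.
Proof.
rewrite all_flatten => h; apply: part_inj => // [|l]; first exact: shape_lt_partition.
rewrite part_shape_lt -row_size lt_count_all //.
case: (ltnP l (size T)) => [lt|le]; first by apply: (allP h); rewrite mem_nth.
by rewrite /row nth_default.
Qed.

Lemma sumn_shape_lt y : sumn (shape_lt T y) = lt_count y (flatten T).
Proof.
rewrite (@sumn_prefix (size T + size (shape_lt T y))) ?leq_addl //.
rewrite /prefix_sum (eq_bigr (fun i : 'I__ => lt_count y (row i))); last first.
  by move=> i _; rewrite part_shape_lt.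
rewrite /lt_count count_flatten sumnE big_map (big_nth [::]) big_mkord.
rewrite big_split_ord /= [X in _ + X]big1 ?addn0 // => i _.
by rewrite /row nth_default // leq_addr.
Qed.

Lemma last_path_of n : last [::] (path_of n T) = shape_lt T n.
Proof.
by case: n => [|n]; rewrite /path_of ?shape_lt0 // mkseqS last_rcons.
Qed.

Lemma hpath_path_of n :
  hpath [::] (mkseq (fun y => count_mem y (flatten T)) n) (path_of n T).
Proof.
elim: n => // n IH; rewrite /path_of !mkseqS hpath_rcons -/(path_of n T) IH.
by rewrite last_path_of shape_lt_strip !sumn_shape_lt lt_countS eqxx.
Qed.

Lemma has_content_mkseq c : has_content c T ->
  mkseq (fun y => count_mem y (flatten T)) (size c) = c.
Proof.
case/andP=> _ /forallP h; apply: (@eq_from_nth _ 0); rewrite size_mkseq // => i lt.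
by rewrite nth_mkseq //; apply/eqP/(h (Ordinal lt)).
Qed.

End SemistandardPath.

Definition row_of (d : nat -> nat) n := flatten (mkseq (fun y => nseq (d y) y) n).

Lemma row_ofS d n : row_of d n.+1 = row_of d n ++ nseq (d n) n.
Proof. by rewrite /row_of mkseqS flatten_rcons. Qed.

Lemma row_of_lt d n : all (fun v => v < n) (row_of d n).
Proof.
elim: n => // n IH; rewrite row_ofS all_cat all_nseq ltnSn orbT andbT.
by apply: sub_all IH => v /ltnW.
Qed.

Lemma sorted_row_of d n : sorted leq (row_of d n).
Proof.
rewrite sorted_pairwise; last exact: leq_trans.
elim: n => // n IH; rewrite row_ofS pairwise_cat IH andTb; apply/andP; split.
  apply/allrelP => u v /(allP (row_of_lt d n)) lt.
  by rewrite mem_nseq => /andP[_ /eqP->]; apply: ltnW.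
by rewrite -sorted_pairwise; [elim: (d n) => // -[|k] //= -> ; rewrite leqnn|exact: leq_trans].
Qed.

Lemma lt_count_row_of d n y : y <= n -> lt_count y (row_of d n) = \sum_(i < y) d i.
Proof.
elim: n y => [|n IH] y; first by rewrite leqn0 => /eqP ->; rewrite big_ord0.
rewrite leq_eqVlt => /orP[/eqP ->|lt]; rewrite row_ofS /lt_count count_cat.
  rewrite big_ord_recr /= count_nseq ltnSn mul1n -IH //; congr (_ + _).
  rewrite -/(lt_count _ _) -/(lt_count _ _) lt_countS -[RHS]addn0; congr (_ + _).
  apply/eqP; rewrite -leqn0 leqNgt -has_count; apply/negP => /hasP[v].
  by move=> /(allP (row_of_lt d n)) + /eqP e; rewrite e ltnn.
by rewrite -/(lt_count _ _) IH // count_nseq ltnNge -ltnS lt mul0n addn0.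
Qed.

(** Prepending [[::]] restores the implicit starting shape, so that entry [y] of the extended list
    is the shape of the letters less than [y]. *)
Definition tableau_row (p : seq (seq nat)) l : seq nat :=
  row_of (fun y => part (nth [::] p y) l - part (nth [::] ([::] :: p) y) l) (size p).

Definition tableau_of_path (p : seq (seq nat)) : tableau :=
  mkseq (tableau_row p) (size (last [::] p)).

Lemma hpath_nth mu c p y : hpath mu c p -> y < size p ->
  hstrip (nth [::] (mu :: p) y) (nth [::] p y) /\
  sumn (nth [::] p y) = sumn (nth [::] (mu :: p) y) + nth 0 c y.
Proof.
elim: p mu c y => [|la q IH] mu [|r c] y //= /and3P[h /eqP e hq].
by case: y => [|y] //= lt; apply: IH hq lt.
Qed.

Section PathTableau.
Variables (c : seq nat) (p : seq (seq nat)).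
Hypothesis hp : hpath [::] c p.

Let P y := nth [::] ([::] :: p) y.

Lemma path_strip y : y < size p -> hstrip (P y) (P y.+1).
Proof. by move=> lt; case: (hpath_nth hp lt). Qed.

Lemma path_sumn y : y < size p -> sumn (P y.+1) = sumn (P y) + nth 0 c y.
Proof. by move=> lt; case: (hpath_nth hp lt). Qed.

Let pP y : y <= size p -> is_partition (P y).
Proof. by case: y => // y lt; apply: hstrip_partr (path_strip lt). Qed.

Lemma path_last : P (size p) = last [::] p.
Proof. by rewrite /P -[size p]/(size ([::] :: p)).-1 nth_last. Qed.

Lemma lt_count_tableau_row y l :
  y <= size p -> lt_count y (tableau_row p l) = part (P y) l.
Proof.
move=> le; rewrite lt_count_row_of //; elim: y le => [|y IH] lt.
  by rewrite big_ord0 nth_nil.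
rewrite big_ord_recr /= IH ?(ltnW lt) //.
case/hstripP: (path_strip lt) => _ _ /(_ l); rewrite /P /=; lia.
Qed.

Lemma tableau_row_sorted l : sorted leq (tableau_row p l).
Proof. exact: sorted_row_of. Qed.

Lemma size_tableau_row l : size (tableau_row p l) = part (last [::] p) l.
Proof.
by rewrite -path_last -lt_count_tableau_row // lt_count_all // row_of_lt.
Qed.

Let plast : is_partition (last [::] p).
Proof. by rewrite -path_last pP. Qed.

Lemma shape_tableau_of_path : shape (tableau_of_path p) = last [::] p.
Proof.
rewrite /shape -map_comp -[RHS](mkseq_nth 0); apply: eq_map => l /=.
exact: size_tableau_row.
Qed.

Lemma nth_tableau_of_path l :
  nth [::] (tableau_of_path p) l = tableau_row p l.
Proof.
case: (ltnP l (size (last [::] p))) => [lt|le]; first by rewrite nth_mkseq.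
rewrite nth_default ?size_mkseq //; apply/esym/nilP.
by rewrite /nilp size_tableau_row nth_default.
Qed.

Lemma semistandard_tableau_of_path : semistandard (tableau_of_path p).
Proof.
apply/and3P; split; first by rewrite shape_tableau_of_path.
  by apply/allP=> r /mapP[l _ ->]; apply: tableau_row_sorted.
apply/(sortedP [::]) => l _; rewrite !nth_tableau_of_path.
apply/allP => j; rewrite mem_iota add0n /= => lt.
have ltv : nth 0 (tableau_row p l.+1) j < size p.
  exact: (allP (row_of_lt _ _) _ (mem_nth 0 lt)).
have : j < lt_count (nth 0 (tableau_row p l.+1) j).+1 (tableau_row p l.+1).
  by rewrite sorted_lt_count ?tableau_row_sorted // lt ltnSn.
rewrite lt_count_tableau_row //; case/hstripP: (path_strip ltv) => _ _ /(_ l).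
move=> /andP[le _] /leq_trans/(_ le); rewrite -lt_count_tableau_row ?(ltnW ltv) //.
by rewrite sorted_lt_count ?tableau_row_sorted // => /andP[].
Qed.

Lemma shape_lt_tableau_of_path y :
  y <= size p -> shape_lt (tableau_of_path p) y = P y.
Proof.
move=> le; have ss := semistandard_tableau_of_path.
apply: part_inj; [exact: shape_lt_partition | exact: pP |] => l.
by rewrite part_shape_lt // nth_tableau_of_path lt_count_tableau_row.
Qed.

Lemma tableau_of_pathK : path_of (size p) (tableau_of_path p) = p.
Proof.
apply: (@eq_from_nth _ [::]); rewrite size_mkseq // => y lt.
by rewrite nth_mkseq // shape_lt_tableau_of_path.
Qed.

Lemma tableau_of_path_lt :
  all (fun v => v < size p) (flatten (tableau_of_path p)).
Proof.
by rewrite all_flatten; apply/allP=> r /mapP[l _ ->]; apply: row_of_lt.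
Qed.

Lemma has_content_tableau_of_path : has_content c (tableau_of_path p).
Proof.
have sz := hpath_size hp; have ss := semistandard_tableau_of_path.
rewrite /has_content -sz tableau_of_path_lt; apply/forallP => -[y lt] /=.
have := lt_countS y (flatten (tableau_of_path p)).
rewrite -!sumn_shape_lt // !shape_lt_tableau_of_path ?(ltnW lt) // path_sumn //.
by move/addnI ->.
Qed.

(** Counts in sorted rows determine the rows. The hypotheses leave out the column condition on [D],
    so the output of jeu de taquin can be identified before it is known to be semistandard. *)
Lemma eq_tableau_of_path (D : tableau) :
  [::] \notin D -> (forall l, sorted leq (nth [::] D l)) ->
  all (fun v => v < size p) (flatten D) ->
  (forall y l, y <= size p -> lt_count y (nth [::] D l) = part (P y) l) ->
  D = tableau_of_path p.
Proof.
move=> nD sD aD h.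
have aDl l : all (fun v => v < size p) (nth [::] D l).
  move: aD; rewrite all_flatten => /allP aD; case: (ltnP l (size D)) => lt.
    by apply: aD; rewrite mem_nth.
  by rewrite nth_default.
have szr l : size (nth [::] D l) = part (last [::] p) l.
  by rewrite -(lt_count_all (aDl l)) h // path_last.
have szD : size D = size (last [::] p).
  have e l : (l < size D) = (l < size (last [::] p)).
    rewrite -part_pos // -szr; case: (ltnP l (size D)) => lt.
      by apply/esym; rewrite lt0n size_eq0; apply: contra nD => /eqP <-; rewrite mem_nth.
    by rewrite nth_default.
  have := e (size D); have := e (size (last [::] p)); rewrite !ltnn; lia.
apply: (@eq_from_nth _ [::]) => [|l _]; first by rewrite size_mkseq.
rewrite nth_tableau_of_path; apply: (@eq_sorted_lt_count (size p)) => //.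
- exact: tableau_row_sorted.
- exact: row_of_lt.
by move=> y le; rewrite h // lt_count_tableau_row.
Qed.

End PathTableau.

Lemma path_ofK n T : semistandard T -> all (fun v => v < n) (flatten T) ->
  tableau_of_path (path_of n T) = T.
Proof.
move=> ss aT; apply/esym/(eq_tableau_of_path (hpath_path_of ss n)).
- case/and3P: ss => /andP[_ n0] _ _; apply: contra n0 => nT.
  by apply/mapP; exists [::].
- exact: semistandard_row.
- by rewrite size_mkseq.
move=> y l; rewrite size_mkseq => le; rewrite -part_shape_lt //.
by case: y le => [|y] lt; rewrite ?shape_lt0 //= nth_path_of.
Qed.

Lemma sum_SSYT (V : nmodType) c (Q : pred tableau) (G : seq nat -> V) :
  (\sum_(T : SSYT c | Q T) G (shape T) =
   \sum_(p <- paths [::] c | Q (tableau_of_path p)) G (last [::] p))%R.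
Proof.
rewrite -(big_map (@tableau_of c) Q (fun T => G (shape T))).
apply: (@big_seq_bij _ _ _ _ _ _ _ (path_of (size c)) tableau_of_path).
- by rewrite map_inj_uniq ?index_enum_uniq //; apply: val_inj.
- exact: paths_uniq.
- move=> T /mapP[[T' /= PT] _ ->] QT; have [ss hc] := andP PT.
  have aT : all (fun v => v < size c) (flatten T') by case/andP: hc.
  have hp := hpath_path_of ss (size c); rewrite has_content_mkseq // in hp.
  rewrite mem_paths hp path_ofK //.
  by rewrite last_path_of // shape_lt_all.
move=> p; rewrite mem_paths => hp Qp; rewrite -(hpath_size hp).
rewrite (tableau_of_pathK hp); split=> //; apply/mapP.
have PT : semistandard (tableau_of_path p) && has_content c (tableau_of_path p).
  by rewrite (semistandard_tableau_of_path hp) (has_content_tableau_of_path hp).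
by exists (MkSSYT PT); rewrite ?mem_index_enum.
Qed.

(** * Schur polynomials as sums over fillings *)

Fixpoint chains n mu : seq (seq (seq nat)) :=
  if n is n'.+1 then
    [seq rcons p mu | s <- [seq s <- partitions_le (sumn mu) | hstrip s mu],
                      p <- chains n' s]
  else if mu == [::] then [:: [::]] else [::].

(** In contrast to [paths], the final shape is fixed and the sizes of the strips are free: a chain
    is a filling of [mu] with letters less than [n]. *)
Lemma mem_chains n mu p :
  (p \in chains n mu) = [&& size p == n, path hstrip [::] p & last [::] p == mu].
Proof.
elim: n mu p => [|n IH] mu p /=; first by case: mu => [|a mu]; case: p.
apply/allpairsPdep/idP => [[s [q [hs hq ->]]]|].
  move: hs hq; rewrite mem_filter IH => /andP[hs _] /and3P[sz hq /eqP e].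
  by rewrite size_rcons eqSS sz rcons_path e hs hq last_rcons eqxx.
case/lastP: p => // p la; rewrite size_rcons eqSS last_rcons rcons_path.
case/and3P=> sz /andP[hp h] /eqP <-; exists (last [::] p), p; split=> //.
  by rewrite mem_filter h mem_partitions_le (hstrip_partl h) hstrip_sumn.
by rewrite IH sz hp /=.
Qed.

Lemma chains_uniq n mu : uniq (chains n mu).
Proof.
elim: n mu => [|n IH] mu /=; first by case: ifP.
apply: allpairs_uniq_dep => //.
  exact/filter_uniq/partitions_le_uniq.
move=> [s p] [s' p'] /allpairsPdep[a [b [_ hb [-> ->]]]].
move=> /allpairsPdep[a' [b' [_ hb' [-> ->]]]] /= /rcons_inj[e].
by move: hb hb'; rewrite !mem_chains e => /and3P[_ _ /eqP->] /and3P[_ _ /eqP->].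
Qed.

Lemma hpath_path mu c p : hpath mu c p -> path hstrip mu p.
Proof. by elim: p mu c => [|la p IH] mu [|r c] //= /and3P[-> _ /IH]. Qed.

Lemma path_hpath mu p : is_partition mu -> path hstrip mu p ->
  exists c, hpath mu c p.
Proof.
elim: p mu => [|la p IH] mu pmu /=; first by exists [::].
case/andP=> h /(IH _ (hstrip_partr h))[c hc].
by exists ((sumn la - sumn mu) :: c); rewrite /= h hc subnKC ?eqxx ?hstrip_sumn.
Qed.

Section ChainSums.
Local Open Scope ring_scope.
Variables (R : comNzRingType) (x : nat -> R).

Definition chain_weight (p : seq (seq nat)) : R :=
  \prod_(y < size p) x y ^+ (sumn (nth [::] p y) - sumn (nth [::] ([::] :: p) y)).

Lemma schur_pol_chains n mu : schur_pol x n mu = \sum_(p <- chains n mu) chain_weight p.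
Proof.
elim: n mu => [|n IH] mu /=.
  by case: eqP => _; rewrite ?big_nil // big_seq1 /chain_weight big_ord0.
rewrite big_allpairs_dep /= big_filter; apply: eq_bigr => s _.
rewrite IH mulr_suml; apply: eq_big_seq => p; rewrite mem_chains.
case/and3P=> /eqP sz _ /eqP e; rewrite /chain_weight size_rcons big_ord_recr /=.
rewrite -rcons_cons !nth_rcons /= sz ltnn eqxx ltnSn; congr (_ * _).
  apply: eq_bigr => i _; rewrite -sz in i *.
  by rewrite -rcons_cons !nth_rcons ltn_ord /= ltnS ltnW.
by rewrite -sz -[size p]/(size ([::] :: p)).-1 nth_last /= e.
Qed.

Lemma prod_letters n (v : seq nat) : all (fun y => (y < n)%N) v ->
  \prod_(y <- v) x y = \prod_(y < n) x y ^+ count_mem (y : nat) v.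
Proof.
elim: v => [|a v IH] /=; first by rewrite big_nil big1.
case/andP=> an /IH e; rewrite big_cons e.
under [RHS]eq_bigr => y _ do rewrite exprD.
rewrite big_split /= [X in _ = X * _](bigD1 (Ordinal an)) //= eqxx expr1 [X in _ * X * _]big1 ?mulr1 // => y ne.
by case: eqP => // e'; case/eqP: ne; apply: val_inj.
Qed.

(** Arbitrary values [x] are allowed in order to cover both the variables themselves and the
    specialisation of the last one to 0. *)
Lemma sum_fillings n mu : is_partition mu ->
  \sum_(w : (sumn mu).-tuple 'I_n | semistandard (reshape mu (map val w)))
    \prod_(i <- w) x (val i) = schur_pol x n mu.
Proof.
move=> pmu; rewrite schur_pol_chains.
transitivity (\sum_(v <- [seq map val (tval w) | w <- enum {: (sumn mu).-tuple 'I_n}]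
                | semistandard (reshape mu v)) \prod_(y <- v) x y).
  rewrite big_map big_enum_cond /=; apply: eq_bigr => w _.
  by rewrite big_map.
have in1 v : v \in [seq map val (tval w) | w <- enum {: (sumn mu).-tuple 'I_n}] ->
    size v = sumn mu /\ all (fun y => (y < n)%N) v.
  case/mapP=> w _ ->; rewrite size_map size_tuple; split=> //.
  by apply/allP => y /mapP[i _ ->]; apply: ltn_ord.
apply: (@big_seq_bij _ _ _ _ _ _ _ (fun v => path_of n (reshape mu v))
          (fun p => flatten (tableau_of_path p))).
- rewrite map_inj_uniq ?enum_uniq // => s t /(inj_map val_inj) e; exact: val_inj.
- exact: chains_uniq.
- move=> v /in1[sz av] ss.
  have shv : shape (reshape mu v) = mu by rewrite reshapeKl // sz.
  have flv : flatten (reshape mu v) = v by rewrite reshapeKr // sz.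
  have hp := hpath_path_of ss n.
  rewrite mem_chains size_mkseq eqxx (hpath_path hp) last_path_of //.
  rewrite shape_lt_all ?flv // shv eqxx path_ofK ?flv //; split=> //.
  rewrite (prod_letters av) /chain_weight size_mkseq; apply: eq_bigr => y _.
  congr (_ ^+ _); have := path_sumn hp; rewrite size_mkseq => /(_ y (ltn_ord y)).
  by rewrite nth_mkseq // flv => -> /=; rewrite addKn.
move=> p; rewrite mem_chains => /and3P[/eqP sz hp /eqP e] _.
have [c hc] := path_hpath (isT : is_partition [::]) hp.
have shp := shape_tableau_of_path hc; rewrite e in shp.
have flK : reshape mu (flatten (tableau_of_path p)) = tableau_of_path p.
  by rewrite -shp flattenK.
have pK := tableau_of_pathK hc; rewrite sz in pK.
rewrite flK pK (semistandard_tableau_of_path hc).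
split=> //; apply/mapP.
have szf : size (flatten (tableau_of_path p)) = sumn mu by rewrite size_flatten shp.
have aN := tableau_of_path_lt p; rewrite sz in aN.
have szt : size (pmap insub (flatten (tableau_of_path p)) : seq 'I_n) == sumn mu.
  by rewrite size_pmap_sub -szf -all_count.
exists (Tuple szt); first by rewrite mem_enum.
rewrite /= pmap_filter; last exact: insubK.
by apply/esym/all_filterP; apply: sub_all aN => y lt /=; rewrite insubT.
Qed.

End ChainSums.

Section SchurFamily.
Local Open Scope ring_scope.
Variable N : nat.

(** The value 0 beyond the N variables is the value that restriction from N + 1 to N variables gives
    to the last one. *)
Definition varX (y : nat) : {mpoly rat[N]} :=
  if insub y is Some i then 'X_i else 0.

Lemma varXE (i : 'I_N) : varX i = 'X_i.
Proof. by rewrite /varX valK. Qed.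

Lemma schurE mu : is_partition mu -> schur mu N = schur_pol varX N mu.
Proof.
move=> pmu; rewrite -sum_fillings //; apply: eq_bigr => w _.
by apply: eq_bigr => i _; rewrite varXE.
Qed.

End SchurFamily.

(** * Jeu de taquin slides *)

(** An empty box ranks below every letter, so the inner shape becomes level 0 of the same family of
    shapes as the letters. *)
Definition key (o : option nat) : nat := if o is Some v then v.+1 else 0.

Definition row_size (S : skew_tableau) l := size (nth [::] S l).

Definition key_count (S : skew_tableau) y l :=
  count (fun o => key o <= y) (nth [::] S l).

Record skew_semistandard (S : skew_tableau) : Prop := Skew {
  skew_shape : forall l, row_size S l.+1 <= row_size S l;
  skew_row : forall l c c', c < c' -> c' < row_size S l ->
    key (box S l c) <= key (box S l c');
  skew_col : forall l l' c, l < l' -> c < row_size S l' ->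
    key (box S l c) < key (box S l' c) \/
    key (box S l c) = 0 /\ key (box S l' c) = 0
}.

(* A skew tableau with a hole at (i, j) which has only moved past keys at most V
   and whose next move is past a key at least V. *)
Record holed (S : skew_tableau) (i j V : nat) : Prop := Holed {
  holed_shape : forall l, row_size S l.+1 <= row_size S l;
  holed_in : j < row_size S i;
  holed_none : box S i j = None;
  holed_row : forall l c c', c < c' -> c' < row_size S l ->
    (l, c) != (i, j) -> (l, c') != (i, j) ->
    key (box S l c) <= key (box S l c');
  holed_col : forall l l' c, l < l' -> c < row_size S l' ->
    (l, c) != (i, j) -> (l', c) != (i, j) ->
    key (box S l c) < key (box S l' c) \/
    key (box S l c) = 0 /\ key (box S l' c) = 0;
  holed_left : forall c, c < j -> key (box S i c) <= V;
  holed_up : forall l, l < i -> key (box S l j) <= V;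
  holed_right : forall c, j < c -> c < row_size S i ->
    V <= key (box S i c) /\ 0 < key (box S i c);
  holed_down : forall l, i < l -> j < row_size S l -> V < key (box S l j)
}.

Lemma row_size_geq S l l' : (forall l, row_size S l.+1 <= row_size S l) ->
  l <= l' -> row_size S l' <= row_size S l.
Proof.
move=> h /subnK <-; elim: (l' - l) => //= k IH.
by rewrite addSn; apply: leq_trans (h _) IH.
Qed.

Lemma box_out S l c : row_size S l <= c -> box S l c = None.
Proof. exact: nth_default. Qed.

Lemma row_size_out S l : size S <= l -> row_size S l = 0.
Proof. by move=> le; rewrite /row_size nth_default. Qed.

Section PutBox.
Variables (S : skew_tableau) (i j : nat) (o : option nat).
Hypothesis ij : j < row_size S i.

Let iS : i < size S.
Proof. by rewrite ltnNge; apply/negP => /row_size_out e; have := ij; rewrite e. Qed.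

Lemma nth_put_box l : nth [::] (put_box S i j o) l =
  if l == i then set_nth None (nth [::] S i) j o else nth [::] S l.
Proof. by rewrite /put_box nth_set_nth. Qed.

Lemma box_put_box l c :
  box (put_box S i j o) l c = if (l, c) == (i, j) then o else box S l c.
Proof.
rewrite /box nth_put_box xpair_eqE; case: eqP => [->|] //=.
by rewrite nth_set_nth.
Qed.

Lemma row_size_put_box l : row_size (put_box S i j o) l = row_size S l.
Proof.
rewrite /row_size nth_put_box; case: eqP => [->|] //.
by rewrite size_set_nth; apply/maxn_idPr.
Qed.

Lemma size_put_box : size (put_box S i j o) = size S.
Proof. by rewrite size_set_nth; apply/maxn_idPr. Qed.

Lemma key_count_put_box y l :
  key_count (put_box S i j o) y l + (l == i) * (key (box S i j) <= y) =
  key_count S y l + (l == i) * (key o <= y).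
Proof.
rewrite /key_count nth_put_box; case: eqP => [->|_]; last by rewrite !mul0n.
rewrite !mul1n count_set_nth_ltn // -/(box S i j) subnK //.
case: (leqP (key (box S i j)) y) => // le.
have : has (fun o => key o <= y) (nth [::] S i).
  by apply/hasP; exists (box S i j); rewrite ?mem_nth.
by rewrite has_count; lia.
Qed.

End PutBox.

Lemma count_prefix (A : Type) (a : pred A) (x0 : A) s n : n <= size s ->
  (forall c, c < n -> a (nth x0 s c)) ->
  (forall c, n <= c -> c < size s -> ~~ a (nth x0 s c)) -> count a s = n.
Proof.
elim: s n => [|x s IH] n /=; first by rewrite leqn0 => /eqP ->.
case: n => [_ _ h|n]; last first.
  rewrite ltnS => le h1 h2; rewrite (h1 0) // (IH n) // => c.
    by move=> lt; apply: (h1 c.+1).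
  by move=> le' lt; apply: (h2 c.+1).
rewrite (negbTE (h 0 _ _)) // (IH 0) // => c _ lt; exact: (h c.+1).
Qed.

Lemma count_le_prefix (A : Type) (a : pred A) (x0 : A) s n :
  (forall c, n <= c -> c < size s -> ~~ a (nth x0 s c)) -> count a s <= n.
Proof.
elim: s n => [|x s IH] [|n] //= h.
  rewrite (negbTE (h 0 _ _)) // add0n; apply: IH => c _ lt; exact: (h c.+1).
apply: (@leq_trans (1 + n)) => //; apply: leq_add; first by case: (a x).
by apply: IH => c le lt; apply: (h c.+1).
Qed.

(** Each of the [i] rows above is nonempty. As every move of the hole raises i + j by one, this
    bounds the number of moves by the fuel. *)
Lemma hook_le_size S i : (forall l, row_size S l.+1 <= row_size S l) ->
  0 < row_size S i -> i + row_size S i <= size (flatten S).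
Proof.
elim: S i => [|r S IH] i h; first by rewrite /row_size nth_nil.
case: i => [|i] /= lt; first by rewrite size_cat leq_addr.
have h' l : row_size S l.+1 <= row_size S l by apply: (h l.+1).
have := IH i h' lt; have := row_size_geq h (leq0n i.+1).
rewrite size_cat /row_size /= in lt *; lia.
Qed.

Section HoleMove.
Variables (S : skew_tableau) (i j V i' j' w : nat).
Hypotheses (hS : holed S i j V) (in' : j' < row_size S i').
Hypothesis box' : box S i' j' = Some w.

Definition move_hole := put_box (put_box S i j (Some w)) i' j' None.

Let neq : (i', j') != (i, j).
Proof. by apply/eqP => -[ei ej]; move: box'; rewrite ei ej (holed_none hS). Qed.

Let ij := holed_in hS.

Let in'' : j' < row_size (put_box S i j (Some w)) i'.
Proof. by rewrite row_size_put_box. Qed.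

Lemma row_size_move l : row_size move_hole l = row_size S l.
Proof. by rewrite !row_size_put_box. Qed.

Lemma size_move : size move_hole = size S.
Proof. by rewrite !size_put_box. Qed.

Lemma box_move l c : box move_hole l c =
  if (l, c) == (i', j') then None else if (l, c) == (i, j) then Some w else box S l c.
Proof. by rewrite !box_put_box. Qed.

Lemma key_count_move y l :
  key_count move_hole y l + (l == i) * (y <= w) =
  key_count S y l + (l == i') * (y <= w).
Proof.
have := key_count_put_box None in'' y l; have := key_count_put_box (Some w) ij y l.
rewrite -/move_hole box_put_box // (negbTE neq) box' (holed_none hS) /=.
by case: eqP => _; case: eqP => _; case: ltngtP; lia.
Qed.

End HoleMove.

Lemma key_some S l c : 0 < key (box S l c) -> exists v, box S l c = Some v.
Proof. by case: (box S l c) => // v _; exists v. Qed.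

Lemma box_some_in S l c v : box S l c = Some v -> c < row_size S l.
Proof. by move=> e; rewrite ltnNge; apply/negP => /box_out; rewrite e. Qed.

(** The entry [r] ends up above [b], and r < b keeps the column strict; this is why a tie sends the
    hole down. The new level is the key of the entry passed. *)
Lemma holed_step_right S i j V r : holed S i j V ->
  box S i j.+1 = Some r -> (forall b, box S i.+1 j = Some b -> r < b) ->
  holed (move_hole S i j i j.+1 r) i j.+1 r.+1.
Proof.
move=> h er hb; have in' := box_some_in er; have sh := holed_shape h.
have qr : key (box S i j.+1) = r.+1 by rewrite er.
have neq : (i, j.+1) != (i, j) by rewrite xpair_eqE; lia.
have [Vr _] := holed_right h (ltnSn j) in'; rewrite qr in Vr.
have rsz := @row_size_geq S _ _ sh.
have colr l l' : l < l' -> j.+1 < row_size S l' ->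
    key (box S l j.+1) < key (box S l' j.+1) \/
    key (box S l j.+1) = 0 /\ key (box S l' j.+1) = 0.
  by move=> lt inl; apply: (holed_col h); rewrite ?xpair_eqE //; lia.
split.
- by move=> l; rewrite !(row_size_move _ h in').
- by rewrite (row_size_move _ h in').
- by rewrite box_move eqxx.
- move=> l c c' lt; rewrite (row_size_move _ h in') => inl n1 n2.
  rewrite !box_move (negbTE n1) (negbTE n2).
  case: eqP => [[el ec]|/eqP n3]; case: eqP => [[el' ec']|/eqP n4].
  + by lia.
  + rewrite el ec in lt inl n2 n4 *; rewrite -[key (Some r)]/(r.+1) -qr; apply: (holed_row h) => //.
    by move: n2; rewrite xpair_eqE eqxx /=; lia.
  + rewrite el' ec' in lt *; apply: leq_trans Vr; exact: (holed_left h).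
  + exact: (holed_row h).
- move=> l l' c lt; rewrite (row_size_move _ h in') => inl n1 n2.
  rewrite !box_move (negbTE n1) (negbTE n2).
  case: eqP => [[el ec]|/eqP n3]; case: eqP => [[el' ec']|/eqP n4].
  + by lia.
  + left; rewrite el ec in lt inl *.
    have in2 : j < row_size S i.+1 by apply: leq_trans inl (rsz _ _ lt).
    have Vb := holed_down h (ltnSn i) in2.
    have [b eb] := key_some (leq_ltn_trans (leq0n _) Vb).
    have lb : r.+1 < key (box S i.+1 j) by rewrite eb ltnS; apply: hb.
    move: lt; rewrite leq_eqVlt => /orP[/eqP<- //|lt].
    have nb l0 : i < l0 -> (l0, j) != (i, j) by rewrite xpair_eqE; lia.
    case: (holed_col h lt inl (nb _ (ltnSn i)) (nb _ (ltnW lt))) => /=; lia.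
  + left; rewrite el' ec' in lt inl *.
    have inl' : j.+1 < row_size S l by apply: leq_trans in' (rsz _ _ (ltnW lt)).
    have nb c0 : (l, c0) != (i, j) by rewrite xpair_eqE; lia.
    have := holed_row h (ltnSn j) inl' (nb _) (nb _).
    case: (colr _ _ lt in') => /=; lia.
  + exact: (holed_col h).
- move=> c lt; rewrite box_move.
  have -> : ((i, c) == (i, j.+1)) = false by rewrite xpair_eqE; lia.
  case: eqP => // /eqP; rewrite xpair_eqE eqxx /= => nc; apply: leq_trans Vr.
  by apply: (holed_left h); lia.
- move=> l lt; rewrite box_move.
  have -> : ((l, j.+1) == (i, j.+1)) = false by rewrite xpair_eqE; lia.
  have -> : ((l, j.+1) == (i, j)) = false by rewrite xpair_eqE; lia.
  by case: (colr _ _ lt in'); lia.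
- move=> c lt; rewrite (row_size_move _ h in') box_move => inc.
  have -> : ((i, c) == (i, j.+1)) = false by rewrite xpair_eqE; lia.
  have -> : ((i, c) == (i, j)) = false by rewrite xpair_eqE; lia.
  have := holed_row h lt inc neq; rewrite qr => le.
  have {}le := le (_ : (i, c) != (i, j)); rewrite xpair_eqE in le; lia.
move=> l lt; rewrite (row_size_move _ h in') box_move => inl.
have -> : ((l, j.+1) == (i, j.+1)) = false by rewrite xpair_eqE; lia.
have -> : ((l, j.+1) == (i, j)) = false by rewrite xpair_eqE; lia.
by case: (colr _ _ lt inl); lia.
Qed.

(** The entry [b] ends up to the left of [r], where a weak inequality is enough; the entries above
    the hole have keys at most [V], and the key of [b] exceeds [V]. *)
Lemma holed_step_down S i j V b : holed S i j V ->
  box S i.+1 j = Some b -> (forall r, box S i j.+1 = Some r -> b <= r) ->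
  holed (move_hole S i j i.+1 j b) i.+1 j b.+1.
Proof.
move=> h eb hr; have in' := box_some_in eb; have sh := holed_shape h.
have qb : key (box S i.+1 j) = b.+1 by rewrite eb.
have neq : (i.+1, j) != (i, j) by rewrite xpair_eqE; lia.
have Vb := holed_down h (ltnSn i) in'; rewrite qb in Vb.
have rowb c c' : c < c' -> c' < row_size S i.+1 ->
    key (box S i.+1 c) <= key (box S i.+1 c').
  by move=> lt inl; apply: (holed_row h); rewrite ?xpair_eqE //; lia.
have downb l : i.+1 < l -> j < row_size S l -> b.+1 < key (box S l j).
  move=> lt inl; have nb : (l, j) != (i, j) by rewrite xpair_eqE; lia.
  by case: (holed_col h lt inl neq nb); lia.
split.
- by move=> l; rewrite !(row_size_move _ h in').
- by rewrite (row_size_move _ h in').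
- by rewrite box_move eqxx.
- move=> l c c' lt; rewrite (row_size_move _ h in') => inl n1 n2.
  rewrite !box_move (negbTE n1) (negbTE n2).
  case: eqP => [[el ec]|/eqP n3]; case: eqP => [[el' ec']|/eqP n4].
  + by lia.
  + rewrite el ec in lt inl n2 n4 *.
    have in1 : j.+1 < row_size S i by apply: leq_ltn_trans lt inl.
    have [_ r0] := holed_right h (ltnSn j) in1.
    have [r er] := key_some r0.
    have lr : b.+1 <= key (box S i j.+1) by rewrite er ltnS; apply: hr.
    move: lt; rewrite leq_eqVlt => /orP[/eqP<- //|lt].
    apply: leq_trans lr _; apply: (holed_row h) => //.
    by rewrite xpair_eqE; lia.
  + rewrite el' ec' in lt *; apply: leq_trans (ltnW Vb); exact: (holed_left h).
  + exact: (holed_row h).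
- move=> l l' c lt; rewrite (row_size_move _ h in') => inl n1 n2.
  rewrite !box_move (negbTE n1) (negbTE n2).
  case: eqP => [[el ec]|/eqP n3]; case: eqP => [[el' ec']|/eqP n4].
  + by lia.
  + left; rewrite el ec in lt inl n2 *; apply: downb => //.
    by move: n2; rewrite xpair_eqE eqxx andbT; lia.
  + left; rewrite el' ec' in lt *; apply: leq_ltn_trans Vb; exact: (holed_up h).
  + exact: (holed_col h).
- move=> c lt; rewrite box_move.
  have -> : ((i.+1, c) == (i.+1, j)) = false by rewrite xpair_eqE; lia.
  have -> : ((i.+1, c) == (i, j)) = false by rewrite xpair_eqE; lia.
  by rewrite -qb; apply: rowb.
- move=> l lt; rewrite box_move.
  have -> : ((l, j) == (i.+1, j)) = false by rewrite xpair_eqE; lia.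
  case: eqP => // /eqP; rewrite xpair_eqE eqxx andbT => nl.
  by apply: leq_trans (ltnW Vb); apply: (holed_up h); lia.
- move=> c lt; rewrite (row_size_move _ h in') box_move => inc.
  have -> : ((i.+1, c) == (i.+1, j)) = false by rewrite xpair_eqE; lia.
  have -> : ((i.+1, c) == (i, j)) = false by rewrite xpair_eqE; lia.
  by have := rowb _ _ lt inc; rewrite qb; lia.
move=> l lt; rewrite (row_size_move _ h in') box_move => inl.
have -> : ((l, j) == (i.+1, j)) = false by rewrite xpair_eqE; lia.
have -> : ((l, j) == (i, j)) = false by rewrite xpair_eqE; lia.
exact: downb.
Qed.

Section EndOfSlide.
Variables (S : skew_tableau) (i j V : nat).
Hypotheses (h : holed S i j V).
Hypotheses (nright : box S i j.+1 = None) (ndown : box S i.+1 j = None).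

(** [box] returns [None] both on empty boxes and outside the diagram. To the right of the hole all
    boxes carry letters, so here [None] means that the row ends. *)
Lemma end_row_size : row_size S i = j.+1.
Proof.
apply/eqP; rewrite eqn_leq (holed_in h) andbT leqNgt; apply/negP => lt.
by have [_] := holed_right h (ltnSn j) lt; rewrite nright.
Qed.

Lemma end_row_size_down : row_size S i.+1 <= j.
Proof.
by rewrite leqNgt; apply/negP => /(holed_down h (ltnSn i)); rewrite ndown.
Qed.

Let R := remove_box S i j.

Let iS : i < size S.
Proof.
by rewrite ltnNge; apply/negP => /row_size_out e; have := holed_in h; rewrite e.
Qed.

Let nthR l : nth [::] R l = if l == i then take j (nth [::] S i) else nth [::] S l.
Proof. by rewrite /R /remove_box nth_set_nth. Qed.

Let szR l : row_size R l + (l == i) = row_size S l.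
Proof.
rewrite /row_size nthR; case: eqP => [->|_]; last by rewrite addn0.
have := end_row_size; rewrite /row_size size_take => ->.
by rewrite ltnSn addn1.
Qed.

Let boxR l c : c < row_size R l -> box R l c = box S l c /\ (l, c) != (i, j).
Proof.
have := szR l; have := end_row_size; rewrite /box /row_size nthR xpair_eqE.
case: eqP => [->|_] //= e e' lt.
by rewrite nth_take; [split=> // |]; lia.
Qed.

Lemma skew_end : skew_semistandard R.
Proof.
have in_S l c : c < row_size R l -> c < row_size S l by have := szR l; lia.
split.
- move=> l; have := szR l; have := szR l.+1; have := holed_shape h l.
  have := end_row_size_down; have := end_row_size.
  case: (eqVneq l i) => [->|_]; last by case: (_ == _); lia.
  by rewrite gtn_eqF //; lia.
- move=> l c c' lt inl; have inl' := ltn_trans lt inl.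
  have [-> n1] := boxR inl; have [-> n2] := boxR inl'.
  exact: (holed_row h) (in_S _ _ inl) n2 n1.
move=> l l' c lt inl.
have shS := holed_shape h.
have nij : (l, c) != (i, j).
  apply/eqP => -[el ec]; rewrite el ec in lt inl *; have := in_S _ _ inl.
  by have := row_size_geq shS lt; have := end_row_size_down; lia.
have inl' : c < row_size R l.
  move: nij; rewrite xpair_eqE; have := szR l; have := end_row_size.
  have := row_size_geq shS (ltnW lt); have := in_S _ _ inl.
  by case: eqP => [->|_] /=; lia.
have [-> n1] := boxR inl; have [-> n2] := boxR inl'.
exact: (holed_col h) (in_S _ _ inl) n2 n1.
Qed.

Lemma size_end : size R = size S.
Proof. by rewrite size_set_nth; apply/maxn_idPr. Qed.

Lemma key_count_end y l : key_count R y l + (l == i) = key_count S y l.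
Proof.
rewrite /key_count nthR; case: eqP => [->|_]; last by rewrite addn0.
rewrite -[in RHS](cat_take_drop j (nth [::] S i)) count_cat; congr (_ + _).
rewrite (drop_nth None); last by have := end_row_size; rewrite /row_size => ->.
rewrite -/(box S i j) (holed_none h) drop_oversize //.
by have := end_row_size; rewrite /row_size => ->.
Qed.

Lemma key_end n : (forall l c, key (box S l c) <= n) ->
  forall l c, key (box R l c) <= n.
Proof.
move=> hn l c; case: (ltnP c (row_size R l)) => [/boxR[-> _]|/box_out->] //.
Qed.

End EndOfSlide.

Section SlideStep.
Variables (S : skew_tableau) (i j V i' j' w : nat).
Hypotheses (h : holed S i j V) (box' : box S i' j' = Some w).

Let in' := box_some_in box'.

Lemma size_flatten_move : size (flatten (move_hole S i j i' j' w)) = size (flatten S).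
Proof.
rewrite !size_flatten; congr sumn; apply: (@eq_from_nth _ 0).
  by rewrite !size_map (size_move _ h in').
move=> l; rewrite size_map (size_move _ h in') => lt.
rewrite !(nth_map [::]) ?(size_move _ h in') //.
exact: (row_size_move _ h in').
Qed.

Lemma key_move n : (forall l c, key (box S l c) <= n) ->
  forall l c, key (box (move_hole S i j i' j' w) l c) <= n.
Proof.
move=> hn l c; rewrite box_move; case: ifP => // _; case: ifP => // _.
by have := hn i' j'; rewrite box'.
Qed.

End SlideStep.

(* k y is the row of the hole once it has passed all keys at most y; the hole goes
   down at level y + 1 when the end of the next row is below it. *)
Definition slide_spec S i V R : Prop :=
  [/\ skew_semistandard R, size R = size S,
      forall n, (forall l c, key (box S l c) <= n) ->
        forall l c, key (box R l c) <= n
    & exists k, [/\ k V = i,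
        forall y, V <= y ->
          k y.+1 = k y + (key_count S y.+1 (k y).+1 == key_count S y (k y)),
        forall y l, V <= y -> key_count R y l + (l == k y) = key_count S y l
      & forall y l, y < V -> key_count R y l + (l == i) = key_count S y l]].

(** Keys to the left of the hole are at most [V], the hole itself has key 0, and keys to its right
    are at least [w]. *)
Lemma key_count_hole S i j V w : holed S i j V ->
  (j.+1 < row_size S i -> w <= key (box S i j.+1)) ->
  forall y, V <= y -> y < w -> key_count S y i = j.+1.
Proof.
move=> h hr y Vy yw; apply: (@count_prefix _ _ None) => [|c|c].
- exact: holed_in h.
- rewrite ltnS leq_eqVlt => /orP[/eqP->|lt].
    by rewrite -/(box S i j) (holed_none h).
  exact: leq_trans (holed_left h lt) Vy.
move=> le inc; rewrite -ltnNge; apply: leq_trans yw _.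
have in1 : j.+1 < row_size S i by apply: leq_ltn_trans inc.
apply: leq_trans (hr in1) _; move: le; rewrite leq_eqVlt => /orP[/eqP<- //|lt].
by apply: (holed_row h); rewrite ?xpair_eqE //; lia.
Qed.

Lemma key_count_below S i j V w : holed S i j V ->
  (j < row_size S i.+1 -> w < key (box S i.+1 j)) ->
  key_count S w i.+1 <= j.
Proof.
move=> h hd; apply: (@count_le_prefix _ _ None) => c le inc; rewrite -ltnNge.
have in1 : j < row_size S i.+1 by apply: leq_ltn_trans inc.
apply: leq_trans (hd in1) _; move: le; rewrite leq_eqVlt => /orP[/eqP<- //|lt].
by apply: (holed_row h); rewrite ?xpair_eqE //; lia.
Qed.

Lemma slide_spec_end S i j V : holed S i j V ->
  box S i j.+1 = None -> box S i.+1 j = None ->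
  slide_spec S i V (remove_box S i j).
Proof.
move=> h nr nd; split.
- exact: skew_end h nr nd.
- exact: size_end h.
- exact: key_end h nr.
exists (fun _ => i); split=> // [y Vy|y l _|y l _]; try exact: key_count_end h nr _ _.
rewrite (@key_count_hole _ _ _ _ y.+1 h) //; last by rewrite (end_row_size h nr) ltnn.
rewrite ltn_eqF ?addn0 // ltnS; apply: (key_count_below h).
by rewrite ltnNge (end_row_size_down h nd).
Qed.

(* Moving past the key w settles the rows of the hole for all levels up to w; from
   level w on, the counts do not see the move. *)
Lemma slide_spec_step S i j V i' j' w R : holed S i j V ->
  box S i' j' = Some w -> V <= w.+1 ->
  (i' = i \/ i' = i.+1 /\ V < w.+1) ->
  (forall y, V <= y -> y < w.+1 ->
     i + (key_count S y.+1 i.+1 == key_count S y i) =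
     if y.+1 == w.+1 then i' else i) ->
  slide_spec (move_hole S i j i' j' w) i' w.+1 R -> slide_spec S i V R.
Proof.
move=> h e Vw hi hk [sR szR bR [k [k0 kS cR cR']]].
have in' := box_some_in e.
have cm := key_count_move h in' e.
split=> //; first by rewrite szR (size_move _ h in').
  by move=> n hn; apply: bR => l c; apply: key_move.
have cge y l : w < y -> key_count (move_hole S i j i' j' w) y l = key_count S y l.
  by move=> lt; have := cm y l; rewrite leqNgt lt !muln0 !addn0.
have clt y l : y <= w -> key_count R y l + (l == i) = key_count S y l.
  move=> le; have := cm y l; have := cR' y l le; rewrite le !muln1; lia.
exists (fun y => if y <= w then i else k y); split.
- case: leqP => // lt; have -> : V = w.+1 by lia.
  by rewrite k0; case: hi => // -[_]; lia.
- move=> y Vy; case: (leqP y w) => [le|lt]; last first.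
    have -> : (y < w) = false by lia.
    by rewrite kS // !cge //; lia.
  rewrite hk // eqSS ltn_neqAle le andbT; case: eqP => // ->.
  by rewrite k0.
- move=> y l Vy; case: (leqP y w) => [le|lt]; first exact: clt.
  by rewrite cR // cge.
by move=> y l lt; apply: clt; lia.
Qed.

Lemma slide_rec_spec fuel S i j V : holed S i j V ->
  size (flatten S) <= fuel + i + j -> slide_spec S i V (slide_rec fuel S i j).
Proof.
elim: fuel S i j V => [|fuel IH] S i j V h sz.
  (* Without fuel, i + j would be at least the number of boxes, against [hook_le_size]. *)
  have in0 : 0 < row_size S i by apply: leq_ltn_trans (holed_in h).
  have := hook_le_size (holed_shape h) in0; have := holed_in h; lia.
have go_right r : box S i j.+1 = Some r ->
    (forall b, box S i.+1 j = Some b -> r < b) ->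
    slide_spec S i V (slide_rec fuel (move_hole S i j i j.+1 r) i j.+1).
  move=> er hb; have hr := holed_step_right h er hb.
  have [Vr _] := holed_right h (ltnSn j) (box_some_in er); rewrite er in Vr.
  apply: (slide_spec_step h er Vr); first by left.
    move=> y Vy yr; rewrite if_same (key_count_hole h _ Vy yr); last by rewrite er.
    rewrite ltn_eqF ?addn0 // ltnS; apply: (key_count_below h) => in1.
    have [b eb] := key_some (leq_ltn_trans (leq0n _) (holed_down h (ltnSn i) in1)).
    by have := hb _ eb; rewrite eb /=; lia.
  by apply: IH => //; rewrite (size_flatten_move h er); lia.
have go_down b : box S i.+1 j = Some b ->
    (forall r, box S i j.+1 = Some r -> b <= r) ->
    slide_spec S i V (slide_rec fuel (move_hole S i j i.+1 j b) i.+1 j).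
  move=> eb hr; have hd := holed_step_down h eb hr.
  have in1 := box_some_in eb.
  have Vb := holed_down h (ltnSn i) in1; rewrite eb in Vb.
  have lr : j.+1 < row_size S i -> b.+1 <= key (box S i j.+1).
    move=> in2; have [_ r0] := holed_right h (ltnSn j) in2.
    by have [r er] := key_some r0; rewrite er ltnS; apply: hr.
  apply: (slide_spec_step h eb (ltnW Vb)); first by right.
    move=> y Vy yb; rewrite (key_count_hole h lr Vy yb).
    case: (y.+1 =P b.+1) => [[->]|ne]; last first.
      rewrite ltn_eqF ?addn0 // ltnS; apply: (key_count_below h) => _.
      by rewrite eb /=; lia.
    (* The letters up to [b] in the row below end exactly under the hole: a further box there lies
       under an entry at least [b], hence exceeds [b]. *)
    have -> : key_count S b.+1 i.+1 = j.+1; last by rewrite eqxx addn1.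
    apply: (@count_prefix _ _ None) => // c.
      rewrite ltnS leq_eqVlt => /orP[/eqP->|lt]; first by rewrite -/(box _ _ _) eb.
      have := holed_row h lt in1; rewrite eb; apply; rewrite xpair_eqE; lia.
    move=> le inc; rewrite -ltnNge -/(box S i.+1 c).
    have in2 : j.+1 < row_size S i.
      by apply: leq_trans (holed_shape h i); apply: leq_ltn_trans inc.
    have in3 : j.+1 < row_size S i.+1 by apply: leq_ltn_trans inc.
    have lt1 : b.+1 < key (box S i.+1 j.+1).
      have n1 : (i, j.+1) != (i, j) by rewrite xpair_eqE; lia.
      have n2 : (i.+1, j.+1) != (i, j) by rewrite xpair_eqE; lia.
      by case: (holed_col h (ltnSn i) in3 n1 n2); have := lr in2; lia.
    move: le; rewrite leq_eqVlt => /orP[/eqP<- //|lt].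
    by apply: leq_trans lt1 _; apply: (holed_row h); rewrite ?xpair_eqE //; lia.
  by apply: IH => //; rewrite (size_flatten_move h eb); lia.
rewrite /=; case eb: (box S i.+1 j) => [b|]; case er: (box S i j.+1) => [r|].
- case: leqP => lt; first by apply: go_down => // r'; rewrite er => -[<-].
  by apply: go_right => // b'; rewrite eb => -[<-].
- by apply: go_down => // r; rewrite er.
- by apply: go_right => // b; rewrite eb.
exact: slide_spec_end.
Qed.

(** * Rectification as switching *)

Section SkewCounts.
Variable S : skew_tableau.
Hypothesis skS : skew_semistandard S.

Lemma key_count_lt y l c :
  (c < key_count S y l) = (c < row_size S l) && (key (box S l c) <= y).
Proof.
have so : sorted leq (map key (nth [::] S l)).
  apply/(sortedP 0) => d; rewrite size_map => lt.
  rewrite !(nth_map None) //; last exact: ltnW.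
  exact: (skew_row skS (ltnSn d)).
have -> : key_count S y l = lt_count y.+1 (map key (nth [::] S l)).
  by rewrite /lt_count count_map.
rewrite sorted_lt_count // size_map -/(row_size S l).
by case: ltnP => // lt; rewrite (nth_map None).
Qed.

Let row_in l c : c < row_size S l.+1 -> c < row_size S l.
Proof. by move=> lt; apply: leq_trans (skew_shape skS l). Qed.

Lemma key_count_strip y l : key_count S y.+1 l.+1 <= key_count S y l.
Proof.
rewrite leqNgt; apply/negP; rewrite key_count_lt => /andP[inl le].
have := key_count_lt y l (key_count S y l); rewrite ltnn (row_in inl) /=.
by case: (skew_col skS (ltnSn l) inl); lia.
Qed.

Lemma key_count_decr y l : key_count S y l.+1 <= key_count S y l.
Proof.
rewrite leqNgt; apply/negP; rewrite key_count_lt => /andP[inl le].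
have := key_count_lt y l (key_count S y l); rewrite ltnn (row_in inl) /=.
by case: (skew_col skS (ltnSn l) inl); lia.
Qed.

Lemma key_count_leS y l : key_count S y l <= key_count S y.+1 l.
Proof. by apply: sub_count => o le; apply: leqW. Qed.

(* The shape formed by the empty boxes and the entries less than y. *)
Definition level y := mkpart (size S) (key_count S y).

Let out y : key_count S y (size S) = 0.
Proof. by rewrite /key_count nth_default. Qed.

Lemma part_level y l : part (level y) l = key_count S y l.
Proof. by apply: part_mkpart => // l'; apply: key_count_decr. Qed.

Lemma level_partition y : is_partition (level y).
Proof. by apply: mkpart_partition => // l'; apply: key_count_decr. Qed.

Lemma level_strip y : hstrip (level y) (level y.+1).
Proof.
apply/hstripP; split=> [||l]; try exact: level_partition.
by rewrite !part_level key_count_strip key_count_leS.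
Qed.

Lemma sumn_level0 : sumn (level 0) = count_mem None (flatten S).
Proof.
rewrite (@sumn_prefix (size S + size (level 0))) ?leq_addl //.
rewrite /prefix_sum (eq_bigr (fun i : 'I__ => key_count S 0 i)); last first.
  by move=> i _; rewrite part_level.
rewrite count_flatten sumnE big_map (big_nth [::]) big_mkord.
rewrite big_split_ord /= [X in _ + X]big1 ?addn0 => [|i _].
  by apply: eq_bigr => i _; apply: eq_count => -[].
by rewrite /key_count nth_default // leq_addr.
Qed.

End SkewCounts.

Definition levels n S := mkseq (fun y => level S y.+1) n.

Lemma path_levels n S : skew_semistandard S -> path hstrip (level S 0) (levels n S).
Proof.
move=> sk; rewrite /levels /mkseq.
by elim: n 0 => //= n IH a; rewrite level_strip //=; apply: IH.
Qed.

Lemma sweep_mkseq (f g : nat -> seq nat) n :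
  (forall y, tog (g y) (f y) (f y.+1) = g y.+1) ->
  sweep (g 0) (f 0) (mkseq (fun y => f y.+1) n) = mkseq (fun y => g y.+1) n.
Proof.
by rewrite /mkseq => e; elim: n 0 => //= n IH a; rewrite e IH.
Qed.

(** A single cell stays in its row, at the new end, unless the next row of [ka] reaches below it, in
    which case it drops by one row. This is the rule that [slide_spec] gives for the row of the
    hole. *)
Lemma part_tog_cell rho la ka i : hstrip rho la -> hstrip la ka ->
  (forall l, part rho l + (l == i) = part la l) ->
  forall l, part (tog rho la ka) l + (l == i + (part ka i.+1 == part la i)) =
            part ka l.
Proof.
move=> h1 h2 e l; rewrite part_tog // /tog_part.
case/hstripP: h1 => _ _ h1; case/hstripP: h2 => _ _ h2.
case: l => [|l].
  move: (e 0) (e 1) (h1 0) (h2 0) (h2 1).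
  by case: (eqVneq i 0) => [->|n0]; lia.
move: (e l) (e l.+1) (h1 l) (h1 l.+1) (h2 l) (h2 l.+1) (h2 l.+2).
by case: (eqVneq i l.+1) => [->|n1]; [|case: (eqVneq i l) => [->|n2]]; lia.
Qed.

(* A horizontal strip may be swept through a path one cell at a time, starting with
   its topmost rightmost cell, here la/la'. *)
Lemma sweep_refine rho la' la i p :
  hstrip rho la -> hstrip rho la' -> hstrip la' la ->
  (forall l, part la' l + (l == i) = part la l) ->
  (forall l, l < i -> part rho l = part la l) -> path hstrip la p ->
  sweep rho la p = sweep rho la' (sweep la' la p).
Proof.
elim: p rho la' la i => //= ka p IH rho la' la i h1 h2 h3 e er /andP[h4 hp].
have cell := part_tog_cell h3 h4 e.
have h5 := tog_hstripl h3 h4; have h6 := tog_hstripr h3 h4.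
set i' := i + _ in cell; set si' := tog la' la ka in cell h5 h6 *.
have h7 := tog_hstripl h1 h4; have h8 := tog_hstripr h1 h4.
have P := part_tog h1 h4; have P' := part_tog h2 h5.
have [_ _ s1] := hstripP _ _ h1; have [_ _ s2] := hstripP _ _ h2.
have [_ _ s4] := hstripP _ _ h4.
(* Locally, toggling the whole strip equals toggling its topmost cell and then the remaining
   strip. *)
have eq_tog : tog rho la' si' = tog rho la ka.
  apply: part_inj; [exact: tog_partition | exact: tog_partition | move=> l].
  rewrite P P' /tog_part; case: l => [|l].
    move: (e 0) (e 1) (er 0) (s1 0) (s2 0) (s4 0) (s4 1) (cell 0) (cell 1).
    rewrite /i'; clear.
    case: (part ka i.+1 =P part la i) => [] E; rewrite ?addn1 ?addn0;
    by case: (eqVneq i 0) E => [->|n0] E; lia.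
  move: (e l) (e l.+1) (e l.+2) (er l) (er l.+1) (s1 l) (s1 l.+1) (s2 l) (s2 l.+1).
  move: (s4 l) (s4 l.+1) (cell l.+1) (cell l.+2); rewrite /i'; clear.
  case: (part ka i.+1 =P part la i) => [] E; rewrite ?addn1 ?addn0 ?eqSS.
    case: (eqVneq i l.+1) E => [->|n1] E; first by lia.
    case: (eqVneq i l) E n1 => [->|n2] E n1; first by lia.
    by case: (eqVneq i l.+2) E n1 n2 => [->|n3] E n1 n2; lia.
  case: (eqVneq i l.+1) E => [->|n1] E; first by lia.
  case: (eqVneq i l) E n1 => [->|n2] E n1; first by lia.
  by case: (eqVneq i l.+2) E n1 n2 => [->|n3] E n1 n2; lia.
rewrite eq_tog; congr cons; apply: (IH _ _ _ i') => //.
  by rewrite -eq_tog; apply: tog_hstripr.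
(* After the step, too, no cell of the strip lies in a row above the distinguished one. *)
move=> l; rewrite P /tog_part /i'; case: l => [|l].
  move: (er 0) (s1 0) (s4 0) (s4 1); clear.
  case: (part ka i.+1 =P part la i) => [] E; rewrite ?addn1 ?addn0;
  by case: (eqVneq i 0) E => [->|n0] E; lia.
move: (er l) (er l.+1) (s1 l) (s1 l.+1) (s4 l) (s4 l.+1); clear.
case: (part ka i.+1 =P part la i) => [] E; rewrite ?addn1 ?addn0;
by case: (eqVneq i l.+1) E => [->|n1] E; lia.
Qed.

Lemma sumn_cell rho la i : (forall l, part rho l + (l == i) = part la l) ->
  sumn la = (sumn rho).+1.
Proof.
move=> e; pose n := size rho + size la + i.+1.
rewrite (@sumn_part n la) ?(@sumn_part n rho) /n; try lia.
under eq_bigr => l _ do rewrite -e.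
rewrite big_split /= -[RHS]addn1; congr (_ + _).
have lt : i < size rho + size la + i.+1 by lia.
rewrite (bigD1 (Ordinal lt)) //= eqxx big1 // => l ne.
by apply/eqP; rewrite eqb0; apply: contra ne => /eqP e'; apply/eqP/val_inj.
Qed.

(** Removing the last cell of Y_mu and sweeping it through [p] first leaves the rectification
    unchanged; this is the effect of one slide. *)
Lemma rect_path_corner mu a rho p :
  is_partition (rcons mu a.+1) -> is_partition rho ->
  (forall l, part rho l + (l == size mu) = part (rcons mu a.+1) l) ->
  path hstrip (rcons mu a.+1) p ->
  rect_path (rcons mu a.+1) p = rect_path rho (sweep rho (rcons mu a.+1) p).
Proof.
move=> pla prho e hp; have [pmu _ _ hla] := is_partition_rcons pla.
rewrite /rect_path row_path_rcons switch_rcons last_row_path /=.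
(* A last row of one cell disappears and [rho] is [mu], so the sweep of that cell is the whole
   sweep. Otherwise the last strip becomes shorter and [sweep_refine] splits the sweep. *)
case: a => [|a] in pla e hp hla *.
  suff -> : rho = mu by [].
  apply: part_inj => // l; move: (e l); rewrite nth_rcons.
  case: (ltngtP l (size mu)) => [lt|gt|->] /=; first by lia.
    by rewrite (@nth_default _ 0 mu l) ?(ltnW gt) //; lia.
  by rewrite (@nth_default _ 0 mu (size mu)) //; lia.
have erho : rho = rcons mu a.+1.
  have sz : size rho = (size mu).+1.
    apply/eqP; rewrite eqn_leq -(part_pos _ prho) leqNgt -(part_pos _ prho).
    move: (e (size mu)) (e (size mu).+1); rewrite !nth_rcons ltnn eqxx.
    by rewrite ltnNge leqnSn /= gtn_eqF //; lia.
  apply: (@eq_from_nth _ 0); rewrite ?size_rcons // => l; rewrite sz ltnS => lt.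
  by move: (e l); rewrite !nth_rcons; case: ltngtP lt => //= _ _; lia.
rewrite erho row_path_rcons switch_rcons last_row_path /= -erho.
congr (switch _ _ _).1.
have hrho : hstrip mu rho.
  by rewrite erho in prho *; have [] := is_partition_rcons prho.
apply: (@sweep_refine _ _ _ (size mu)) => //.
  apply/hstripP; split=> // l; move: (e l) (e l.+1) (part_le l prho) (part_le l pla).
  by case: eqP => [->|]; lia.
by move=> l lt; rewrite nth_rcons lt.
Qed.

(** The hole starts at level 0: to its left and above it there are only empty boxes, and, as it is
    the last empty box of the last row of the inner shape, only letters to its right and below. *)
Lemma slide_cornerP S : skew_semistandard S -> level S 0 != [::] ->
  slide_spec S (size (level S 0)).-1 0 (slide_corner S).
Proof.
move=> sk ne; have pl := level_partition sk 0.
set i := (size (level S 0)).-1.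
have szl : size (level S 0) = i.+1 by rewrite /i; case: (level S 0) ne.
have hasN l : (None \in nth [::] S l) = (l <= i).
  rewrite -ltnS -szl -(part_pos _ pl) part_level // -has_count.
  apply/idP/hasP => [Nl|[[//|] Nl _]]; first by exists None.
  by [].
have iS : i < size S.
  rewrite ltnNge; apply/negP => le; have := hasN i.
  by rewrite leqnn nth_default.
have corner : last 0 [seq l <- iota 0 (size S) | None \in nth [::] S l] = i.
  rewrite (eq_filter hasN).
  have -> : iota 0 (size S) = iota 0 i.+1 ++ iota i.+1 (size S - i.+1).
    by rewrite -iotaD subnKC.
  rewrite filter_cat [X in _ ++ X](_ : _ = [::]); last first.
    apply/eqP; rewrite -[_ == _]negbK -has_filter; apply/hasPn => l.
    by rewrite mem_iota -ltnNge => /andP[].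
  rewrite cats0 (_ : [seq l <- _ | _] = iota 0 i.+1); last first.
    by apply/all_filterP/allP => l; rewrite mem_iota.
  by rewrite -nth_last size_iota nth_iota.
have cnt : count_mem None (nth [::] S i) = key_count S 0 i.
  by apply: eq_count => -[].
have cnt0 : 0 < key_count S 0 i by rewrite -part_level // part_pos // szl.
rewrite /slide_corner corner /slide cnt; set j := (key_count S 0 i).-1.
have ij : j < key_count S 0 i by rewrite /j prednK.
have := key_count_lt sk 0 i j; rewrite ij => /esym/andP[inj kj].
have zero l c : key (box S l c) <= 0 -> c < row_size S l -> c < key_count S 0 l.
  by move=> le lt; rewrite key_count_lt // lt le.
apply: slide_rec_spec; last by rewrite -addnA leq_addr.
split=> //.
- exact: skew_shape.
- by case: (box S i j) kj.
- by move=> l c c' lt inl _ _; apply: skew_row.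
- by move=> l l' c lt inl _ _; apply: skew_col.
- by move=> c lt; apply: leq_trans kj; apply: skew_row.
- by move=> l lt; case: (skew_col sk lt inj); lia.
- move=> c lt inc; split=> //; rewrite ltnNge; apply/negP => /zero/(_ inc).
  by rewrite /j in lt; lia.
move=> l lt inl; rewrite ltnNge; apply/negP => /zero/(_ inl).
rewrite -(part_level sk) nth_default // szl.
exact: lt.
Qed.

(** Induction on the number of empty boxes. At each level a slide removes the cell in the row of the
    hole, and these cells follow the toggle rule of [part_tog_cell]; hence the new levels are the
    sweep of one cell of Y_mu, and [rect_path_corner] applies. *)
Lemma rect_levels n S : skew_semistandard S -> (forall l c, key (box S l c) <= n) ->
  let F := iter (count_mem None (flatten S)) slide_corner S in
  [/\ skew_semistandard F, forall l c, key (box F l c) <= n, level F 0 = [::]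
    & levels n F = rect_path (level S 0) (levels n S)].
Proof.
move=> sk; rewrite -sumn_level0 //; move: {2}(sumn _) (erefl (sumn (level S 0))) => d.
elim: d S sk => [|d IH] S sk ed bS.
  rewrite ed; have -> : level S 0 = [::].
    have := size_part_le (level_partition sk 0); rewrite ed.
    by case: (level S 0).
  split=> //; have := size_part_le (level_partition sk 0); rewrite ed.
  by case: (level S 0).
rewrite ed iterSr; have ne : level S 0 != [::] by case: (level S 0) ed.
have [sR szR bR [k [k0 kS cR _]]] := slide_cornerP sk ne.
set R := slide_corner S in sR szR bR cR *.
have cell y l : part (level R y) l + (l == k y) = part (level S y) l.
  by rewrite !part_level // cR.
have hRS y : hstrip (level R y) (level S y).
  have pS := level_partition sk y; have pR := level_partition sR y.
  apply/hstripP; split=> // l; move: (cell y l) (cell y l.+1).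
  by move: (part_le l pS) (part_le l pR); case: (eqVneq l (k y)) => [->|ne']; lia.
have eq_tog y : tog (level R y) (level S y) (level S y.+1) = level R y.+1.
  have hS := level_strip sk y.
  apply: part_inj; [exact: tog_partition | exact: level_partition | move=> l].
  have := part_tog_cell (hRS y) hS (cell y) l; have := cell y.+1 l.
  by rewrite kS // !part_level //; lia.
have [mu [a ea]] : exists mu a, level S 0 = rcons mu a.+1.
  have pS := level_partition sk 0.
  case/lastP: (level S 0) ne pS => // mu b _ pb; exists mu, b.-1.
  by have [_ b0 _ _] := is_partition_rcons pb; rewrite prednK.
have eR : sumn (level R 0) = d.
  by have := sumn_cell (cell 0); rewrite ed => -[].
have [] := IH R sR eR (bR _ bS); rewrite eR => h1 h2 h3 h4.
have sw : sweep (level R 0) (level S 0) (levels n S) = levels n R.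
  exact: sweep_mkseq eq_tog.
split=> //; rewrite h4 -sw.
rewrite ea; apply/esym/rect_path_corner; rewrite -?ea.
- exact: level_partition.
- exact: level_partition.
- by move=> l; rewrite -(cell 0 l) k0 ea size_rcons.
exact: path_levels.
Qed.

Lemma nth_filter_nonempty (A : Type) (s : seq (seq A)) l :
  (forall l, size (nth [::] s l.+1) <= size (nth [::] s l)) ->
  nth [::] [seq r <- s | ~~ nilp r] l = nth [::] s l.
Proof.
elim: s l => // r s IH l h.
have {}IH l' := IH l' (fun l => h l.+1).
case: r h IH => [|a r] h IH /=; last by case: l.
have nils l' : nth [::] s l' = [::].
  apply/nilP; rewrite /nilp -leqn0; elim: l' => [|l' IHl]; first exact: (h 0).
  exact: leq_trans (h l'.+1) IHl.
by rewrite IH nils; case: l => //= l; rewrite nils.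
Qed.

Section SomeRow.
Variable r : seq (option nat).
Hypothesis r_some : all isSome r.

Lemma map_key_some : map key r = map succn (pmap id r).
Proof. by elim: r r_some => //= -[v|] s IH //= /IH ->. Qed.

Lemma lt_count_some y : lt_count y (pmap id r) = count (fun o => key o <= y) r.
Proof.
rewrite -(count_map key (fun v => v <= y)) map_key_some count_map.
exact: eq_count.
Qed.

Lemma sorted_some : sorted leq (map key r) -> sorted leq (pmap id r).
Proof. by rewrite map_key_some sorted_map. Qed.

Lemma size_some : size (pmap id r) = size r.
Proof. by rewrite -(size_map succn) -map_key_some size_map. Qed.

End SomeRow.

Lemma rect_eq_path n S : skew_semistandard S -> (forall l c, key (box S l c) <= n) ->
  rect S = tableau_of_path (rect_path (level S 0) (levels n S)).
Proof.
move=> skS bS; have [skF bF F0 eF] := rect_levels skS bS.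
rewrite /rect; set F := iter _ _ _ in skF bF F0 eF *; rewrite -eF.
have [c hc] : exists c, hpath [::] c (levels n F).
  have [c hc] := path_hpath (level_partition skS 0) (path_levels n skS).
  by exists c; rewrite eF; apply: rect_pathP.
have someF l : all isSome (nth [::] F l).
  have := part_level skF 0 l; rewrite F0 nth_nil => /esym/eqP.
  rewrite -leqn0 leqNgt -has_count => /hasPn h; apply/allP => o /h.
  by case: o.
have sz l : size (nth [::] F l.+1) <= size (nth [::] F l) := skew_shape skF l.
have nthD l : nth [::] [seq pmap id row | row <- F & row != [::]] l =
    pmap id (nth [::] F l).
  rewrite -(nth_filter_nonempty _ sz).
  set G := [seq r <- F | ~~ nilp r].
  have -> : [seq row <- F | row != [::]] = G by apply: eq_filter => -[].
  case: (ltnP l (size G)) => [lt|le]; first by rewrite (nth_map [::]).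
  by rewrite !nth_default ?size_map.
have rowP row : row \in F -> exists l, row = nth [::] F l.
  by case/(nthP [::]) => l _ <-; exists l.
apply: (eq_tableau_of_path hc).
- apply/mapP => -[row]; rewrite mem_filter => /andP[ne /rowP[l el]].
  move=> /(congr1 size); rewrite size_some el // => /esym/size0nil e.
  by rewrite el e in ne.
- move=> l; rewrite nthD; apply: sorted_some => //.
  apply/(sortedP 0) => d; rewrite size_map => lt.
  rewrite !(nth_map None) //; last exact: ltnW.
  exact: (skew_row skF (ltnSn d)).
- rewrite size_mkseq all_flatten; apply/allP => r /mapP[row].
  rewrite mem_filter => /andP[_ /rowP[l el]] -> {r}; apply/allP => v.
  rewrite mem_pmap map_id => vrow.
  have := bF l (index (Some v) row); rewrite /box -el nth_index //.
move=> y l; rewrite size_mkseq => le; rewrite nthD lt_count_some //.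
rewrite -/(key_count F y l) -part_level //.
case: y le => [|y] lt; first by rewrite F0.
by congr (part _ l); apply/esym; apply: (nth_mkseq [::] (fun y => level F y.+1) lt).
Qed.

(** * The components of Dec_m as rectified blocks *)

Section SkewPart.
Variables (m i : nat) (T : tableau).
Hypothesis ssT : semistandard T.

Let row l := nth [::] T l.
Let S := skew_part m i T.

Lemma semistandard_col l l' c : l < l' -> c < size (row l') ->
  c < size (row l) /\ nth 0 (row l) c < nth 0 (row l') c.
Proof.
have step k d : d < size (row k.+1) ->
    d < size (row k) /\ nth 0 (row k) d < nth 0 (row k.+1) d.
  move=> lt; have := semistandard_strip ssT (nth 0 (row k.+1) d) k.
  have : d < lt_count (nth 0 (row k.+1) d).+1 (row k.+1).
    by rewrite sorted_lt_count ?semistandard_row // lt ltnSn.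
  move=> /leq_trans h /h.
  by rewrite sorted_lt_count ?semistandard_row // => /andP[].
move=> /subnK <-; elim: (l' - l.+1) => [|k IH]; first exact: step.
rewrite addSn => /step[lt1 lt2]; have [h1 h2] := IH lt1.
by split=> //; apply: ltn_trans lt2.
Qed.

Let nthS l : nth [::] S l =
  [seq (if x < i * m then None else Some (x - i * m))
  | x <- take (lt_count (i.+1 * m) (row l)) (row l)].
Proof.
have take_filter r a : sorted leq r -> [seq x <- r | x < a] = take (lt_count a r) r.
  elim: r => //= x r IH sr; rewrite /lt_count /=; case: ltnP => [lt|ge] /=.
    by rewrite IH ?(path_sorted sr).
  rewrite (eq_in_count (a2 := pred0)) => [|y yr]; last first.
    apply/negbTE; rewrite -leqNgt; apply: leq_trans ge _.
    exact: (allP (order_path_min leq_trans sr)).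
  rewrite count_pred0 /=; apply/eqP; rewrite -[_ == _]negbK -has_filter.
  apply/hasPn => y yr; rewrite -leqNgt; apply: leq_trans ge _.
  exact: (allP (order_path_min leq_trans sr)).
rewrite -take_filter ?semistandard_row // /S /skew_part /row.
case: (ltnP l (size T)) => [lt|le]; first by rewrite (nth_map [::]).
by rewrite !nth_default ?size_map.
Qed.

Let sizeS l : row_size S l = lt_count (i.+1 * m) (row l).
Proof.
rewrite /row_size nthS size_map size_takel //; exact: count_size.
Qed.

(** Truncated subtraction gives key 0 to the letters of earlier blocks, which become empty boxes. *)
Let keyS l c : c < row_size S l -> key (box S l c) = (nth 0 (row l) c).+1 - i * m.
Proof.
move=> lt; have := lt; rewrite sizeS => lt'.
rewrite /box nthS (nth_map 0) ?nth_take //; first by case: ltnP => /=; lia.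
by move: lt; rewrite /row_size nthS size_map.
Qed.

Lemma skew_part_semistandard : skew_semistandard S.
Proof.
split.
- move=> l; rewrite !sizeS.
  exact: leq_trans (lt_count_le _ (leqnSn _)) (semistandard_strip ssT _ _).
- move=> l c c' lt inl; rewrite !keyS //; last exact: ltn_trans inl.
  have szr : row_size S l <= size (row l) by rewrite sizeS count_size.
  have so := sorted_leq_nth leq_trans leqnn 0 (semistandard_row ssT l).
  apply: leq_sub2r; rewrite ltnS; apply: so (ltnW lt).
    exact: leq_trans (ltn_trans lt inl) szr.
  exact: leq_trans inl szr.
move=> l l' c lt inl; have inl' := inl.
rewrite sizeS sorted_lt_count ?semistandard_row // in inl'.
have /andP[szl' xl'] := inl'; have [szl ltx] := semistandard_col lt szl'.
have inS : c < row_size S l.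
  rewrite sizeS sorted_lt_count ?semistandard_row // szl /=; exact: ltn_trans xl'.
by rewrite !keyS //; lia.
Qed.

Lemma key_skew_part l c : key (box S l c) <= m.
Proof.
case: (ltnP c (row_size S l)) => [lt|/box_out->] //.
rewrite keyS //; move: lt; rewrite sizeS sorted_lt_count ?semistandard_row //.
by move=> /andP[_]; rewrite mulSn; lia.
Qed.

Lemma level_skew_part y : y <= m -> level S y = shape_lt T (i * m + y).
Proof.
move=> le; have sk := skew_part_semistandard.
apply: part_inj; [exact: level_partition | exact: shape_lt_partition | move=> l].
rewrite part_level // part_shape_lt // /key_count /S /skew_part.
have -> : nth [::] [seq [seq (if x < i * m then None else Some (x - i * m))
    | x <- r & x < i.+1 * m] | r <- T] l =
    [seq (if x < i * m then None else Some (x - i * m))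
    | x <- row l & x < i.+1 * m].
  rewrite /row; case: (ltnP l (size T)) => [lt|ge]; first by rewrite (nth_map [::]).
  by rewrite !nth_default ?size_map.
rewrite count_map count_filter; apply: eq_count => x /=.
by rewrite mulSn; case: ltnP => /=; lia.
Qed.

Lemma Dec_eq_path :
  Dec m i T = tableau_of_path
    (rect_path (shape_lt T (i * m)) (mkseq (fun y => shape_lt T (i * m + y.+1)) m)).
Proof.
rewrite /Dec (rect_eq_path skew_part_semistandard key_skew_part).
rewrite level_skew_part // addn0; congr (tableau_of_path (rect_path _ _)).
by apply/eq_in_map => y; rewrite mem_iota => /andP[_ lt]; rewrite level_skew_part.
Qed.

End SkewPart.

Lemma nth_rect_blocks m mu cs p i : all (fun c => size c == m) cs -> i < size cs ->
  nth [::] (rect_blocks mu cs p) i =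
  rect_path (last mu (take (i * m) p)) (take m (drop (i * m) p)).
Proof.
elim: cs mu p i => // c cs IH mu p [|i] /= /andP[/eqP -> hcs] lt.
  by rewrite take0 drop0.
by rewrite IH // mulSn takeD drop_drop last_cat addnC.
Qed.

Lemma Dec_tableau_of_path lam m p i :
  hpath [::] (content_pow lam m) p -> i < size lam ->
  Dec m i (tableau_of_path p) =
  tableau_of_path (nth [::] (rect_blocks [::] [seq nseq m l | l <- lam] p) i).
Proof.
move=> hp lt; have ss := semistandard_tableau_of_path hp.
have szp : size p = size lam * m.
  rewrite (hpath_size hp) /content_pow size_flatten /shape -map_comp.
  by elim: (lam) => //= a s ->; rewrite size_nseq.
have le : i * m + m <= size p by rewrite szp addnC -mulSn leq_mul2r lt orbT.
rewrite (@nth_rect_blocks m) ?size_map //; last first.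
  by rewrite all_map; apply/allP => l _ /=; rewrite size_nseq.
rewrite Dec_eq_path //.
have lev y : y <= size p -> shape_lt (tableau_of_path p) y = last [::] (take y p).
  move=> ley; rewrite (shape_lt_tableau_of_path hp) //.
  case: y ley => [|y] ley; first by rewrite take0.
  by rewrite (take_nth [::]) // last_rcons.
rewrite lev; last by lia.
congr (tableau_of_path (rect_path _ _)).
apply: (@eq_from_nth _ [::]); rewrite size_mkseq ?size_takel // ?size_drop; try lia.
move=> y lty; rewrite nth_mkseq // nth_take // nth_drop.
by rewrite (shape_lt_tableau_of_path hp) ?addnS //; lia.
Qed.

(** * Complete symmetric functions *)

Section CompleteSymmetric.
Local Open Scope ring_scope.

Lemma schur_mPo mu N k (T : N.-tuple {mpoly rat[k]}) :
  schur mu N \mPo T =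
  \sum_(w : (sumn mu).-tuple 'I_N | semistandard (reshape mu (map val w)))
    \prod_(i <- w) tnth T i.
Proof.
rewrite /schur raddf_sum /=; apply: eq_bigr => w _; rewrite rmorph_prod /=.
by apply: eq_bigr => i _; rewrite /= comp_mpolyXU (tnth_nth 0).
Qed.

(** What matters is a bound independent of [N]; the factor 3 is a coarse allowance for each variable
    of the product. *)
Lemma msize_prod_var N (w : seq 'I_N) :
  (msize (\prod_(i <- w) 'X_i : {mpoly rat[N]}) <= (3 * size w).+1)%N.
Proof.
elim: w => [|i w IH]; first by rewrite big_nil msize1.
rewrite big_cons; apply: leq_trans (msizeM_le _ _) _.
by rewrite msizeX mdeg1; move: IH => /=; lia.
Qed.

Lemma msize_schur mu N : (msize (schur mu N) <= (3 * sumn mu).+1)%N.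
Proof.
apply: leq_trans (msize_sum _ _ _) _; apply/bigmax_leqP => w _.
by apply: leq_trans (msize_prod_var _) _; rewrite size_tuple.
Qed.

(** A smaller shape [s] leaves a positive power of x_n, which is 0. The term of [mu] itself survives
    with exponent 0, and a strip with no cells forces s = mu. *)
Lemma schur_pol_last0 (R : comNzRingType) (x : nat -> R) n mu : is_partition mu ->
  x n = 0 -> schur_pol x n.+1 mu = schur_pol x n mu.
Proof.
move=> pmu xn /=; rewrite -big_filter (bigD1_seq mu) /=; first last.
- exact/filter_uniq/partitions_le_uniq.
- by rewrite mem_filter hstrip_refl // mem_partitions_le pmu leqnn.
rewrite subnn mulr1 big_seq_cond big1 ?addr0 // => s.
rewrite mem_filter => /andP[/andP[h _] ne].
suff lt : (sumn s < sumn mu)%N by rewrite xn expr0n subn_eq0 leqNgt lt mulr0.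
rewrite ltn_neqAle hstrip_sumn // andbT; apply: contra ne => /eqP e.
have [ps _ hs] := hstripP _ _ h; have szs := hstrip_size h.
have ez : prefix_sum s (size mu) = prefix_sum mu (size mu).
  by rewrite -!sumn_prefix.
apply/eqP/part_inj => // l; case: (ltnP l (size mu)) => [lt|ge]; last first.
  by rewrite !nth_default //; apply: leq_trans szs ge.
have le k : (prefix_sum s k <= prefix_sum mu k)%N.
  by apply: prefix_sum_le => l'; case/andP: (hs l').
elim: (size mu) ez lt => // k IH; rewrite !prefix_sumS ltnS => ez.
have := le k; have := hs k; rewrite (leq_eqVlt l) => /andP[_ lek] le'.
have [e1 e2] : prefix_sum s k = prefix_sum mu k /\ part s k = part mu k by lia.
by case/orP => [/eqP-> //|lt]; apply: IH.
Qed.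

Lemma schur_restrict mu N : is_partition mu ->
  schur mu N.+1 \mPo
    [tuple if unlift ord_max i is Some j then 'X_j else 0 | i < N.+1] = schur mu N.
Proof.
move=> pmu; rewrite schur_mPo.
transitivity (\sum_(w : (sumn mu).-tuple 'I_N.+1 | semistandard (reshape mu (map val w)))
    \prod_(i <- w) varX N (val i)).
  apply: eq_bigr => w _; apply: eq_bigr => i _; rewrite tnth_mktuple.
  rewrite -[val i]/(nat_of_ord i); case: unliftP => [j ->|->].
    by rewrite lift_max varXE.
  by rewrite /varX insubF ?ltnn.
rewrite sum_fillings // schurE // schur_pol_last0 //.
by rewrite /varX insubF ?ltnn.
Qed.

Lemma sorted_semistandard r (v : seq nat) : (0 < r)%N -> size v = r ->
  semistandard (reshape [:: r] v) = sorted leq v.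
Proof.
move=> r0 sz; rewrite /semistandard /is_partition /= take_oversize ?sz //.
by rewrite inE eq_sym -lt0n r0 /= !andbT.
Qed.

(** A one-row tableau is a multiset of letters: permuting the letters and sorting again is a
    bijection on such rows, with inverse given by the inverse permutation. *)
Lemma hsym_symmetric r N : (0 < r)%N -> hsym r N \is mpoly.symmetric.
Proof.
move=> r0; apply/issymP => s.
have -> : msym s (hsym r N) = hsym r N \mPo [tuple 'X_(s i) | i < N].
  rewrite -[LHS]comp_mpoly_id msym_mPo; congr (_ \mPo _).
  by apply: eq_from_tnth => i; rewrite !tnth_mktuple.
rewrite schur_mPo /hsym /schur.
pose leo (i j : 'I_N) := (i <= j)%N.
have leo_tr : transitive leo by move=> a b c; apply: leq_trans.
have leo_tot : total leo by move=> a b; apply: leq_total.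
have leo_anti : antisymmetric leo by move=> a b /anti_leq/val_inj.
have so (w : (sumn [:: r]).-tuple 'I_N) :
    semistandard (reshape [:: r] (map val w)) = sorted leo w.
  by rewrite sorted_semistandard // ?size_map ?size_tuple /= ?addn0 // sorted_map.
pose f (u : {perm 'I_N}) (w : (sumn [:: r]).-tuple 'I_N) :=
  [tuple of sort leo [tuple of map u w]].
have fK (u u' : {perm 'I_N}) (w : (sumn [:: r]).-tuple 'I_N) : cancel u' u -> sorted leo w -> f u (f u' w) = w.
  move=> uK sw; apply: val_inj => /=; rewrite -[RHS](sorted_sort leo_tr sw).
  apply/perm_sortP => //; rewrite -[X in perm_eq _ X](mapK uK).
  by apply: perm_map; rewrite perm_sort.
rewrite [LHS](reindex_onto (f s^-1%g) (f s)) /=; last first.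
  by move=> w; rewrite so => sw; apply: fK => // i; rewrite permK.
apply: eq_big => w.
  rewrite !so /= sort_sorted // andTb; apply/eqP/idP => [<- /=|sw].
    exact: sort_sorted.
  by apply: fK => // i; rewrite permKV.
move=> _; rewrite (perm_big _ (permEl (perm_sort leo _))) big_map.
by apply: eq_bigr => i _; rewrite tnth_mktuple permKV.
Qed.

End CompleteSymmetric.

(** * Types of tableaux of content lam^m *)

Local Open Scope ring_scope.

Lemma symmetric_function_hsym r : (0 < r)%N -> symmetric_function (hsym r).
Proof.
move=> r0; have pr : is_partition [:: r] by rewrite /is_partition /= inE eq_sym -lt0n r0.
split=> [N|N|]; first exact: hsym_symmetric.
  exact: schur_restrict.
by exists (3 * sumn [:: r]).+1 => N; apply: msize_schur.
Qed.

Lemma is_partition_tuple_gt0 k (lam : k.-tuple nat) (i : 'I_k) :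
  is_partition lam -> (0 < tnth lam i)%N.
Proof.
case/andP=> _ no0; rewrite lt0n; apply: contra no0 => /eqP <-.
exact: mem_tnth.
Qed.

Theorem mainTheorem8 (m k : nat) (type : seq (seq nat) -> SYT m)
    (F : {ffun 'I_k -> SYT m} -> SYT m) (lam : k.-tuple nat) :
  (0 < m)%N -> type_attribution type -> Kronecker_map F -> is_partition lam ->
  forall (t : SYT m) (N : nat),
    plethysm (schur (shape t)) (prod_family (fun i : 'I_k => hsym (tnth lam i))) N
    = \sum_(T : SSYT (content_pow lam m) | composed_type type F T == t)
        schur (shape T) N.
Proof.
move=> m0 attr kron plam t N.
have lam0 i : (0 < tnth lam i)%N := is_partition_tuple_gt0 i plam.
rewrite kron; last by move=> i; apply: symmetric_function_hsym.
pose cs := [seq nseq m l | l <- lam].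
have szcs : size cs = k by rewrite size_map size_tuple.
pose ty p (i : nat) : SYT m :=
  type (tableau_of_path (nth [::] (rect_blocks [::] cs p) i)).
pose S := schur_pol (varX N) N.
have schurS c p : p \in paths [::] c -> schur (last [::] p) N = S (last [::] p).
  by rewrite mem_paths => /hpath_partr; apply: schurE.
(* For a fixed tuple of types, the type attribution turns each factor into a sum over tableaux of
   rectangular content, and the rule for blocks merges the product into one sum over paths. *)
have types_of (u : {ffun 'I_k -> SYT m}) :
    \prod_(i < k) plethysm (schur (shape (u i))) (hsym (tnth lam i)) N =
    \sum_(p <- paths [::] (flatten cs) | [forall i : 'I_k, ty p i == u i])
      S (last [::] p).
  (* Blocks are indexed by natural numbers and [u] by ['I_k]; the default [true] concerns indices
     from k on. *)
  pose Q i p := if insub i is Some j then type (tableau_of_path p) == u j else true.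
  transitivity (S [::] * \prod_(i < size cs)
      \sum_(v <- paths [::] (nth [::] cs i) | Q i v) S (last [::] v)).
    rewrite /S schur_pol_nil mul1r szcs; apply: eq_bigr => i _.
    rewrite attr // (sum_SSYT _ (fun T => type T == u i) (schur^~ N)).
    rewrite (nth_map 0%N) ?size_tuple // -tnth_nth big_seq_cond [RHS]big_seq_cond.
    apply: eq_big => v; first by rewrite /Q valK.
    by case/andP => /schurS.
  rewrite -sum_rect_blocks //; apply: eq_bigl => p; rewrite szcs.
  apply/allP/forallP => [h i|h i].
    by have := h i; rewrite mem_iota /Q valK; apply; apply: ltn_ord.
  rewrite mem_iota => /andP[_ lt]; rewrite /Q insubT; exact: h (Ordinal lt).
under eq_bigr => u _ do rewrite types_of.
rewrite (sum_SSYT _ (fun T => composed_type type F T == t) (schur^~ N)).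
(* With the sum over paths outside, each path meets exactly one [u], the tuple of types of its
   blocks, and contributes precisely when [F] sends this tuple to [t]. *)
rewrite (exchange_big_dep xpredT) //= big_mkcond [RHS]big_mkcond /=.
apply: eq_big_seq => p pin; have hp := pin; rewrite mem_paths in hp.
have ct : composed_type type F (tableau_of_path p) = F [ffun i : 'I_k => ty p i].
  rewrite /composed_type; congr (F _); apply/ffunP => i; rewrite !ffunE /ty.
  by rewrite (Dec_tableau_of_path hp) // size_tuple.
rewrite ct; case: ifP => Ft.
  rewrite (big_pred1 [ffun i : 'I_k => ty p i]) ?(schurS _ _ pin) // => u.
  apply/andP/eqP => [[_ /forallP h]|->]; last first.
    by split=> //; apply/forallP => i; rewrite ffunE.
  by apply/ffunP => i; rewrite ffunE; apply/esym/eqP.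
rewrite big_pred0 // => u; apply/negP => /andP[/eqP Fu /forallP h].
case/eqP: Ft; rewrite -Fu; congr (F _); apply/ffunP => i; rewrite ffunE.
exact/eqP.
Qed.
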